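(* Let $n\in\mathbb{N}$ ($n=0$ allowed), $z_0\in\mathbb{D}$ and $\gamma=(\gamma_0,\ldots,\gamma_n)\in\mathbb{D}^{n+1}$. Let $$\mathcal{S}(\gamma)=\{f\in\mathcal{S}: f(z_0)=\gamma_0,\ H^1f(z_0)=\gamma_1,\ \ldots,\ H^nf(z_0)=\gamma_n\},\qquad V(z,\gamma)=\{f(z): f\in\mathcal{S}(\gamma)\}.$$ Then for each fixed $z\in\mathbb{D}\setminus\{z_0\}$, $$V(z,\gamma)=\{f_{\gamma,\varepsilon}(z):\varepsilon\in\overline{\mathbb{D}}\}=\overline{\mathbb{D}}(c(z),\rho(z)),$$ where $$c(z)=\frac{\overline{B_n(z)}\,\widetilde B_n(z)-|T_{-z_0}(z)|^2\,\overline{A_n(z)}\,\widetilde A_n(z)}{|B_n(z)|^2-|T_{-z_0}(z)|^2|A_n(z)|^2},\qquad \rho(z)=\frac{|T_{-z_0}(z)|^{n+1}\prod_{k=0}^n(1-|\gamma_k|^2)}{|B_n(z)|^2-|T_{-z_0}(z)|^2|A_n(z)|^2}.$$ Furthermore, for $f\in\mathcal{S}(\gamma)$, one has $f(z)\in\partial\mathbb{D}(c(z),\rho(z))$ if and only if $f\equiv f_{\gamma,\varepsilon}$ for some $\varepsilon\in\partial\mathbb{D}$.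
   Context: $\mathbb{D}=\{|z|<1\}$; $\mathbb{D}(c,\rho)$ and $\overline{\mathbb{D}}(c,\rho)$ are the open and closed disks with center $c$ and radius $\rho$; $\mathcal{S}$ is the Schur class of analytic functions $f$ on $\mathbb{D}$ with $|f|\le1$. For $a\in\mathbb{D}$, $T_a(z)=(z+a)/(1+\bar az)$. For $z,w\in\overline{\mathbb{D}}$ with $z\overline w\neq1$, $[z,w]=\frac{z-w}{1-\overline wz}$. For $z_0\in\mathbb{D}$, the operator $\Delta_{z_0}:\mathcal{S}\to\mathcal{S}$ is given by $\Delta_{z_0}f(z)=\frac{[f(z),f(z_0)]}{[z,z_0]}$ for $z\neq z_0$ and $\Delta_{z_0}f(z_0)=\frac{(1-|z_0|^2)f'(z_0)}{1-|f(z_0)|^2}$ if $f$ is not a unimodular constant (and $\Delta_{z_0}f\equiv0$ if $f$ is a unimodular constant). The hyperbolic derivative of order $j$ of $f$ at $z_0$ is $H^jf(z_0)=(\Delta_{z_0}^jf)(z_0)$, where $\Delta_{z_0}^j$ is the $j$-fold iterate of $\Delta_{z_0}$. Rational functions $A_k,\widetilde A_k,B_k,\widetilde B_k$ ($k=0,\ldots,n$) are defined by $$\begin{pmatrix} A_0 & \widetilde A_0 \\ B_0 & \widetilde B_0 \end{pmatrix}=\begin{pmatrix} \overline{\gamma_0} & 1 \\ 1 & \gamma_0 \end{pmatrix},\qquad \begin{pmatrix} A_{k+1}(z) & \widetilde A_{k+1}(z) \\ B_{k+1}(z) & \widetilde B_{k+1}(z) \end{pmatrix}=\begin{pmatrix}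 T_{-z_0}(z) & \overline{\gamma_{k+1}} \\ \gamma_{k+1}T_{-z_0}(z) & 1 \end{pmatrix}\begin{pmatrix} A_k(z) & \widetilde A_k(z) \\ B_k(z) & \widetilde B_k(z) \end{pmatrix}$$ for $k=0,\ldots,n-1$. For $\varepsilon\in\overline{\mathbb{D}}$ and $z\in\mathbb{D}$, $$f_{\gamma,\varepsilon}(z)=T_{\gamma_0}(T_{-z_0}(z)\,T_{\gamma_1}(\cdots T_{-z_0}(z)\,T_{\gamma_n}(\varepsilon T_{-z_0}(z))\cdots)).$$ *)

(* Defs.v *)
From Stdlib Require Import Reals ClassicalEpsilon.
From Coquelicot Require Import Coquelicot.

Open Scope C_scope.

Definition disk (c : C) (rho : R) (z : C) : Prop := (Cmod (z - c) < rho)%R.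
Definition closed_disk (c : C) (rho : R) (z : C) : Prop := (Cmod (z - c) <= rho)%R.
Definition disk_boundary (c : C) (rho : R) (z : C) : Prop := Cmod (z - c) = rho.

Definition unit_disk : C -> Prop := disk 0 1.

(* Functions on the unit disk are represented by total functions [C -> C]; their
   values outside the disk are never constrained. *)

Definition analytic_at (f : C -> C) (a : C) : Prop :=
  exists (c : nat -> C) (r : R), (0 < r)%R /\
    forall z : C, disk a r z ->
      @is_pseries C_AbsRing C_NormedModule c (z - a) (f z).

Definition schur (f : C -> C) : Prop :=
  (forall a, unit_disk a -> analytic_at f a) /\
  (forall z, unit_disk z -> (Cmod (f z) <= 1)%R).

Definition T (a z : C) : C := (z + a) / (1 + Cconj a * z).

Definition bracket (z w : C) : C := (z - w) / (1 - Cconj w * z).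

Definition unimodular_constant (f : C -> C) : Prop :=
  exists c : C, Cmod c = 1%R /\ forall z, unit_disk z -> f z = c.

Definition Delta_h (z0 : C) (f : C -> C) (z : C) : C :=
  if excluded_middle_informative (unimodular_constant f) then 0
  else if Ceq_dec z z0 then
    RtoC (1 - Cmod z0 ^ 2) * C_derive f z0 / RtoC (1 - Cmod (f z0) ^ 2)
  else bracket (f z) (f z0) / bracket z z0.

Definition hyp_derive (j : nat) (f : C -> C) (z0 : C) : C :=
  Nat.iter j (Delta_h z0) f z0.

(* A tuple (gamma_0, ..., gamma_n) is a sequence [gamma : nat -> C] together with [n];
   the entries of index greater than [n] are never used. *)

Definition schur_interp (n : nat) (z0 : C) (gamma : nat -> C) (f : C -> C) : Prop :=
  schur f /\ f z0 = gamma 0%nat /\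
  forall j : nat, (1 <= j <= n)%nat -> hyp_derive j f z0 = gamma j.

Definition V (n : nat) (z0 : C) (gamma : nat -> C) (z w : C) : Prop :=
  exists f : C -> C, schur_interp n z0 gamma f /\ w = f z.

Definition mx2 (a b c d : C) : @matrix C 2 2 := [[a, b], [c, d]].

Fixpoint AB (z0 : C) (gamma : nat -> C) (k : nat) (z : C) : @matrix C 2 2 :=
  match k with
  | O => mx2 (Cconj (gamma O)) 1 1 (gamma O)
  | S k' =>
      @Mmult C_Ring 2 2 2
        (mx2 (T (- z0) z) (Cconj (gamma k)) (gamma k * T (- z0) z) 1)
        (AB z0 gamma k' z)
  end.

Definition A (z0 : C) (gamma : nat -> C) (k : nat) (z : C) : C :=
  coeff_mat (0 : C) (AB z0 gamma k z) 0 0.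
Definition A_tilde (z0 : C) (gamma : nat -> C) (k : nat) (z : C) : C :=
  coeff_mat (0 : C) (AB z0 gamma k z) 0 1.
Definition B (z0 : C) (gamma : nat -> C) (k : nat) (z : C) : C :=
  coeff_mat (0 : C) (AB z0 gamma k z) 1 0.
Definition B_tilde (z0 : C) (gamma : nat -> C) (k : nat) (z : C) : C :=
  coeff_mat (0 : C) (AB z0 gamma k z) 1 1.

(* For n = 0 this is T_{gamma_0}(eps T_{-z0}(z)); each successor step prepends one
   more T_{gamma_0}(T_{-z0}(z) _ ) in front of the function of the shifted tuple. *)
Fixpoint f_gamma (n : nat) (z0 : C) (gamma : nat -> C) (eps z : C) : C :=
  match n with
  | O => T (gamma O) (eps * T (- z0) z)
  | S m => T (gamma O) (T (- z0) z * f_gamma m z0 (fun k => gamma (S k)) eps z)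
  end.

Definition denom (n : nat) (z0 : C) (gamma : nat -> C) (z : C) : R :=
  (Cmod (B z0 gamma n z) ^ 2 - Cmod (T (- z0) z) ^ 2 * Cmod (A z0 gamma n z) ^ 2)%R.

Definition center (n : nat) (z0 : C) (gamma : nat -> C) (z : C) : C :=
  (Cconj (B z0 gamma n z) * B_tilde z0 gamma n z
   - RtoC (Cmod (T (- z0) z) ^ 2) * Cconj (A z0 gamma n z) * A_tilde z0 gamma n z)
  / RtoC (denom n z0 gamma z).

Definition radius (n : nat) (z0 : C) (gamma : nat -> C) (z : C) : R :=
  (Cmod (T (- z0) z) ^ (n + 1) * prod_f_R0 (fun k => 1 - Cmod (gamma k) ^ 2) n
   / denom n z0 gamma z)%R.

(* Main.v *)
Require Import Defs.
From Stdlib Require Import Reals Lra Lia ClassicalEpsilon List Wf_nat.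
From Coquelicot Require Import Coquelicot.
Open Scope C_scope.

(* By the Schwarz-Pick lemma (the maximum principle applied to Delta f), Delta maps Schur
   functions to Schur functions, and f = T_{f(z0)}(T_{-z0} Delta f). Iterating, the members
   of S(gamma) are exactly the functions zeta |-> f_{gamma, g(zeta)}(zeta) with g an arbitrary
   Schur function, so V(z, gamma) is the image of the closed disk under
   eps |-> f_{gamma, eps}(z). This map is a Moebius transformation with matrix
   [T_{-z0} A~_n, B~_n; T_{-z0} A_n, B_n], and f_{gamma, eps}(z) - c(z) is rho(z) times a
   unimodular constant times a disk automorphism applied to eps. Boundary values correspond
   to |g(z)| = 1, which forces g to be constant. *)

(** * Power series as towers of divided remainders *)

(** [analytic_at] is purely local: a convergent power series at each point, with no integral formula
    behind it. Two facts must therefore be won from coefficients alone: dividing out a zero leaves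
    an analytic function, so that [Delta_h] is analytic at [z0], and the maximum principle. A power
    series is traded for the sequence of its divided remainders with a geometric bound, on which
    products, inverses and division by [z - a] become finite algebra. Local constancy at a maximum
    then spreads along segments. The strict bounds on the [gamma k] keep the functions met at stages
    0 to [n] away from the unimodular constants, where [Delta_h] degenerates; only the final
    parameter [g] may be one, and exactly these give boundary points. *)

Lemma pow_n_Cpow (x : C) (k : nat) : pow_n (K := C_Ring) x k = x ^ k.
Proof. induction k as [|k IH]; [reflexivity|]. simpl. now rewrite IH. Qed.

Lemma is_pseries_C (c : nat -> C) (x l : C) :
  @is_pseries C_AbsRing C_NormedModule c x l <->
  forall eps : R, (0 < eps)%R -> exists N, forall n, (N <= n)%nat ->
    (Cmod (sum_n (G := C_AbelianMonoid) (fun k => (x ^ k * c k)%C) n - l) < eps)%R.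
Proof.
  unfold is_pseries, is_series.
  rewrite (filterlim_locally_ball_norm (U := C_NormedModule)).
  assert (E : forall n, sum_n (fun k => scal (pow_n (K := C_AbsRing) x k) (c k : C_NormedModule)) n
    = sum_n (G := C_AbelianMonoid) (fun k => (x ^ k * c k)%C) n).
  { intros n. apply sum_n_ext. intros k. now rewrite <- pow_n_Cpow. }
  split.
  - intros H eps he. destruct (H (mkposreal eps he)) as [N HN].
    exists N. intros n hn. specialize (HN n hn). unfold ball_norm in HN.
    rewrite E in HN. exact HN.
  - intros H eps. destruct (H eps (cond_pos eps)) as [N HN].
    exists N. intros n hn. specialize (HN n hn). unfold ball_norm.
    rewrite E. exact HN.
Qed.

Lemma sum_n_C_S (u : nat -> C) (n : nat) :
  sum_n (G := C_AbelianMonoid) u (S n) = sum_n (G := C_AbelianMonoid) u n + u (S n).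
Proof. now rewrite sum_Sn. Qed.

Lemma sum_n_C_O (u : nat -> C) : sum_n (G := C_AbelianMonoid) u 0 = u 0%nat.
Proof. now rewrite sum_O. Qed.

Lemma is_pseries_C_unique (c : nat -> C) (x l l' : C) :
  @is_pseries C_AbsRing C_NormedModule c x l ->
  @is_pseries C_AbsRing C_NormedModule c x l' -> l = l'.
Proof.
  intros H H'. exact (filterlim_locally_unique _ _ _ H H').
Qed.

(** Two consecutive partial sums are eventually both close to [l], so the terms tend to 0, and a
    convergent real sequence is bounded. *)
Lemma pseries_terms_bounded (c : nat -> C) (x l : C) :
  @is_pseries C_AbsRing C_NormedModule c x l ->
  exists M : R, (0 < M)%R /\ forall n, (Cmod (x ^ n * c n) <= M)%R.
Proof.
  intros H. rewrite is_pseries_C in H.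
  assert (Hcv : Un_cv (fun n => Cmod (x ^ n * c n)) 0).
  { intros eps he. destruct (H (eps / 2)%R ltac:(lra)) as [N HN].
    exists (S N). intros n hn. destruct n as [|n]; [lia|].
    unfold Rdist. rewrite Rminus_0_r, Rabs_pos_eq by apply Cmod_ge_0.
    assert (h1 := HN n ltac:(lia)). assert (h2 := HN (S n) ltac:(lia)).
    rewrite sum_n_C_S in h2.
    set (s := sum_n _ n) in *.
    replace (x ^ S n * c (S n)) with ((s + x ^ S n * c (S n) - l) + - (s - l)) by ring.
    eapply Rle_lt_trans; [apply Cmod_triangle|]. rewrite Cmod_opp. lra. }
  destruct (maj_by_pos _ (exist _ _ Hcv)) as [M [hM HM]].
  exists M. split; [exact hM|]. intros n. specialize (HM n).
  now rewrite Rabs_pos_eq in HM by apply Cmod_ge_0.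
Qed.

(** A geometric majorant of ratio at most 1/2 sums to at most [2 * B]; the induction carries the
    exact partial sum [B * (2 - (/ 2) ^ n)]. *)
Lemma pseries_bound (c : nat -> C) (x l : C) (B K : R) :
  (0 <= B)%R -> (0 <= K)%R -> (K * Cmod x <= / 2)%R ->
  (forall k, (Cmod (c k) <= B * K ^ k)%R) ->
  @is_pseries C_AbsRing C_NormedModule c x l -> (Cmod l <= 2 * B)%R.
Proof.
  intros hB hK hx hc H. rewrite is_pseries_C in H.
  assert (Hs : forall n, (Cmod (sum_n (G := C_AbelianMonoid) (fun k => (x ^ k * c k)%C) n)
    <= B * (2 - (/ 2) ^ n))%R).
  { assert (Ht : forall k, (Cmod (x ^ k * c k) <= B * (/ 2) ^ k)%R).
    { intros k. rewrite Cmod_mult, Cmod_pow.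
      apply Rle_trans with (Cmod x ^ k * (B * K ^ k))%R.
      - apply Rmult_le_compat_l; [apply pow_le, Cmod_ge_0|apply hc].
      - replace (Cmod x ^ k * (B * K ^ k))%R with (B * (K * Cmod x) ^ k)%R
          by (rewrite Rpow_mult_distr; ring).
        apply Rmult_le_compat_l; [exact hB|]. apply pow_incr.
        split; [|exact hx]. apply Rmult_le_pos; [exact hK|apply Cmod_ge_0]. }
    induction n as [|n IH].
    - rewrite sum_n_C_O. specialize (Ht 0%nat). simpl in *. lra.
    - rewrite sum_n_C_S. eapply Rle_trans; [apply Cmod_triangle|].
      specialize (Ht (S n)). simpl (_ ^ S n)%R in *. lra. }
  apply Rnot_lt_le. intros hl.
  destruct (H (Cmod l - 2 * B)%R ltac:(lra)) as [N HN].
  specialize (HN N (le_n N)). specialize (Hs N). set (s := sum_n _ N) in *.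
  assert (Cmod l <= Cmod (s - l) + Cmod s)%R.
  { replace l with (- (s - l) + s) at 1 by ring.
    eapply Rle_trans; [apply Cmod_triangle|]. rewrite Cmod_opp. lra. }
  assert (0 < (/2) ^ N)%R by (apply pow_lt; lra). nra.
Qed.

(* [F n] is the n-th divided remainder of [F 0] at 0: the coefficient recursion
   and the geometric bound together encode a convergent power series without
   mentioning infinite sums. *)
Definition tower (F : nat -> C -> C) (d M K : R) : Prop :=
  forall n h, (Cmod h < d)%R ->
    F n h = F n 0 + h * F (S n) h /\ (Cmod (F n h) <= M * K ^ n)%R.

(** The remainder [sum_k c (n + k) h^k], computed from values of [f] by repeated subtraction and
    division. Division says nothing at [h = 0], so for positive [n] the coefficient is put there. *)
Fixpoint tails (c : nat -> C) (f : C -> C) (n : nat) (h : C) : C :=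
  match n with
  | O => f h
  | S m => if Ceq_dec h 0 then c (S m) else (tails c f m h - c m) / h
  end.

Lemma tails_pseries (c : nat -> C) (f : C -> C) (h : C) (n : nat) :
  @is_pseries C_AbsRing C_NormedModule c h (f h) ->
  @is_pseries C_AbsRing C_NormedModule (fun k => c (n + k)%nat) h (tails c f n h).
Proof.
  intros H. induction n as [|n IH]; [exact H|]. simpl tails.
  destruct (Ceq_dec h 0) as [->|hh].
  - replace (c (S n)) with (c (S n + 0)%nat) by (f_equal; lia).
    apply (is_pseries_0 (K := C_AbsRing) (V := C_NormedModule) (fun k => c (S n + k)%nat)).
  - assert (E := is_pseries_decr_1 (K := C_AbsRing) (V := C_NormedModule)
      _ _ (/ h) _ (Cinv_l h hh) IH).
    replace ((tails c f n h - c n) / h)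
      with (scal (K := C_AbsRing) (V := C_NormedModule) (/ h)
             (plus (tails c f n h : C_NormedModule) (opp (c (n + 0)%nat : C_NormedModule)))).
    + eapply is_pseries_ext; [|exact E]. intros k. unfold PS_decr_1. f_equal. lia.
    + rewrite Nat.add_0_r. change (/ h * (tails c f n h - c n) = (tails c f n h - c n) / h).
      unfold Cdiv. ring.
Qed.

Lemma analytic_tower (f : C -> C) (a : C) :
  analytic_at f a ->
  exists F d M K, (0 < d)%R /\ (0 <= M)%R /\ (0 < K)%R /\ tower F d M K /\
    forall h, (Cmod h < d)%R -> F 0%nat h = f (a + h).
Proof.
  intros [c [r [hr H]]].
  assert (H' : forall h, (Cmod h < r)%R ->
    @is_pseries C_AbsRing C_NormedModule c h (f (a + h))).
  { intros h hh. replace h with (a + h - a) at 1 by ring. apply H.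
    unfold disk. now replace (a + h - a) with h by ring. }
  (* The terms of the series at the point [r / 2] are bounded, which gives coefficients of growth at
     most [(2 / r) ^ k]. *)
  set (K := (2 / r)%R).
  assert (hK : (0 < K)%R) by (apply Rdiv_lt_0_compat; lra).
  assert (hc : exists M, (0 < M)%R /\ forall k, (Cmod (c k) <= M * K ^ k)%R).
  { destruct (pseries_terms_bounded c (RtoC (r / 2)) _ (H' (RtoC (r/2))
      ltac:(rewrite Cmod_R, Rabs_pos_eq; lra))) as [M [hM HM]].
    exists M. split; [exact hM|]. intros k. specialize (HM k).
    rewrite Cmod_mult, Cmod_pow, Cmod_R, Rabs_pos_eq in HM by lra.
    assert (0 < K ^ k)%R by (apply pow_lt; exact hK).
    replace (Cmod (c k)) with ((r / 2) ^ k * Cmod (c k) * K ^ k)%R.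
    - apply Rmult_le_compat_r; [lra|exact HM].
    - replace ((r / 2) ^ k * Cmod (c k) * K ^ k)%R with (Cmod (c k) * ((r / 2) * K) ^ k)%R
        by (rewrite Rpow_mult_distr; ring).
      replace (r / 2 * K)%R with 1%R by (unfold K; field; lra).
      rewrite pow1. ring. }
  destruct hc as [M [hM hc]].
  (* On [Cmod h < r / 4] the ratio [K * Cmod h] is at most 1/2, so the tail from [n] on is at most
     [2 * (M * K ^ n)]. *)
  exists (tails c (fun h => f (a + h))), (r / 4)%R, (2 * M)%R, K.
  repeat split; try lra.
  - assert (E0 : tails c (fun h => f (a + h)) n 0 = c n).
    { destruct n as [|n].
      - simpl. apply (is_pseries_C_unique c 0).
        + apply H'. rewrite Cmod_0. lra.
        + apply (is_pseries_0 (K := C_AbsRing) (V := C_NormedModule) c).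
      - simpl. destruct (Ceq_dec 0 0) as [_|k]; [reflexivity|now case k]. }
    rewrite E0. simpl. destruct (Ceq_dec h 0) as [->|hh].
    + rewrite E0. ring.
    + field. exact hh.
  - rewrite Rmult_assoc.
    apply (pseries_bound (fun k => c (n + k)%nat) h _ (M * K ^ n)%R K).
    + apply Rmult_le_pos; [lra|]. apply pow_le. lra.
    + lra.
    + apply Rle_trans with (K * (r / 4))%R.
      * apply Rmult_le_compat_l; lra.
      * unfold K. right. field. lra.
    + intros k. rewrite Rmult_assoc, <- pow_add. apply hc.
    + apply tails_pseries. apply H'. lra.
Qed.

Lemma tower_partial_sum (F : nat -> C -> C) (d M K : R) (h : C) (n : nat) :
  tower F d M K -> (Cmod h < d)%R ->
  F 0%nat h = sum_n (G := C_AbelianMonoid) (fun k => (h ^ k * F k 0)%C) n + h ^ S n * F (S n) h.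
Proof.
  intros HF hh. induction n as [|n IH].
  - rewrite sum_n_C_O, (proj1 (HF 0%nat h hh)). simpl. ring.
  - rewrite sum_n_C_S, IH, (proj1 (HF (S n) h hh)). simpl. ring.
Qed.

(** Conversely, the coefficients are the values [F n 0]. After [n] steps the error is
    [h ^ S n * F (S n) h], at most [M * (/ 2) ^ S n] once [K * Cmod h <= / 2]. *)
Lemma tower_analytic (f : C -> C) (a : C) (F : nat -> C -> C) (d M K : R) :
  (0 < d)%R -> (0 <= M)%R -> (0 < K)%R -> tower F d M K ->
  (forall h, (Cmod h < d)%R -> F 0%nat h = f (a + h)) -> analytic_at f a.
Proof.
  intros hd hM hK HF Hf.
  exists (fun n => F n 0), (Rmin d (/ (2 * K))). split.
  { apply Rmin_pos; [exact hd|]. apply Rinv_0_lt_compat. lra. }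
  intros z hz. unfold disk in hz. set (h := z - a) in *.
  assert (hd' : (Cmod h < d)%R) by (eapply Rlt_le_trans; [exact hz|apply Rmin_l]).
  assert (hK' : (K * Cmod h <= / 2)%R).
  { assert (Cmod h < / (2 * K))%R by (eapply Rlt_le_trans; [exact hz|apply Rmin_r]).
    apply Rle_trans with (K * / (2 * K))%R; [apply Rmult_le_compat_l; lra|].
    right. field. lra. }
  replace (f z) with (F 0%nat h) by (rewrite Hf by exact hd'; f_equal; unfold h; ring).
  apply is_pseries_C. intros eps he.
  assert (hM1 : (0 < eps / (M + 1))%R) by (apply Rdiv_lt_0_compat; lra).
  destruct (pow_lt_1_zero (/ 2) ltac:(rewrite Rabs_pos_eq; lra) _ hM1) as [N HN].
  exists N. intros n hn.
  rewrite (tower_partial_sum F d M K h n HF hd').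
  set (s := sum_n _ n).
  replace (s - (s + h ^ S n * F (S n) h)) with (- (h ^ S n * F (S n) h)) by ring.
  rewrite Cmod_opp, Cmod_mult, Cmod_pow.
  specialize (HN (S n) ltac:(lia)).
  assert (hp : (0 < (/ 2) ^ S n)%R) by (apply pow_lt; lra).
  rewrite Rabs_pos_eq in HN by lra.
  apply Rle_lt_trans with (M * (/ 2) ^ S n)%R.
  - apply Rle_trans with (Cmod h ^ S n * (M * K ^ S n))%R.
    + apply Rmult_le_compat_l; [apply pow_le, Cmod_ge_0|].
      apply (HF (S n) h hd').
    + replace (Cmod h ^ S n * (M * K ^ S n))%R with (M * (K * Cmod h) ^ S n)%R
        by (rewrite Rpow_mult_distr; ring).
      apply Rmult_le_compat_l; [exact hM|]. apply pow_incr.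
      split; [|exact hK']. apply Rmult_le_pos; [lra|apply Cmod_ge_0].
  - apply Rle_lt_trans with ((M + 1) * (/ 2) ^ S n)%R; [nra|].
    apply Rlt_le_trans with ((M + 1) * (eps / (M + 1)))%R.
    + apply Rmult_lt_compat_l; lra.
    + right. field. lra.
Qed.

(** * Algebra of analytic functions *)

Lemma tower_weaken (F : nat -> C -> C) (d M K d' M' K' : R) :
  tower F d M K -> (d' <= d)%R -> (M <= M')%R -> (0 <= M)%R -> (0 <= K <= K')%R ->
  tower F d' M' K'.
Proof.
  intros HF hd hM hM0 hK n h hh. destruct (HF n h ltac:(lra)) as [H1 H2].
  split; [exact H1|]. eapply Rle_trans; [exact H2|].
  apply Rmult_le_compat; try lra; [apply pow_le; lra|]. now apply pow_incr.
Qed.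

Lemma analytic_tower2 (f g : C -> C) (a : C) :
  analytic_at f a -> analytic_at g a ->
  exists F G d M K, (0 < d)%R /\ (0 <= M)%R /\ (0 < K)%R /\ tower F d M K /\ tower G d M K /\
    (forall h, (Cmod h < d)%R -> F 0%nat h = f (a + h)) /\
    (forall h, (Cmod h < d)%R -> G 0%nat h = g (a + h)).
Proof.
  intros Hf Hg.
  destruct (analytic_tower f a Hf) as (F & d & M & K & hd & hM & hK & HF & Ef).
  destruct (analytic_tower g a Hg) as (G & d' & M' & K' & hd' & hM' & hK' & HG & Eg).
  assert (h1 := Rmin_l d d'). assert (h2 := Rmin_r d d').
  assert (h3 := Rmax_l M M'). assert (h4 := Rmax_r M M').
  assert (h5 := Rmax_l K K'). assert (h6 := Rmax_r K K').
  exists F, G, (Rmin d d'), (Rmax M M'), (Rmax K K').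
  split; [now apply Rmin_pos|]. split; [lra|]. split; [lra|].
  split; [apply (tower_weaken F d M K); lra || assumption|].
  split; [apply (tower_weaken G d' M' K'); lra || assumption|].
  split; intros h hh; [apply Ef | apply Eg]; lra.
Qed.

Lemma analytic_const (c a : C) : analytic_at (fun _ => c) a.
Proof.
  apply (tower_analytic _ a (fun n _ => match n with O => c | _ => 0 end) 1 (Cmod c) 1);
    try lra; [apply Cmod_ge_0| |reflexivity].
  intros n h _. split; destruct n; try ring; rewrite pow1; [lra|].
  rewrite Cmod_0. assert (k := Cmod_ge_0 c). lra.
Qed.

Lemma analytic_id (a : C) : analytic_at (fun z => z) a.
Proof.
  assert (k := Cmod_ge_0 a).
  apply (tower_analytic _ a
    (fun n h => match n with O => a + h | 1%nat => 1 | _ => 0 end) 1 (Cmod a + 1) 1);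
    try lra; [|reflexivity].
  intros n h hh. split; destruct n as [|[|n]]; try ring; rewrite pow1.
  - eapply Rle_trans; [apply Cmod_triangle|lra].
  - rewrite Cmod_1. lra.
  - rewrite Cmod_0. lra.
Qed.

Lemma analytic_plus (f g : C -> C) (a : C) :
  analytic_at f a -> analytic_at g a -> analytic_at (fun z => f z + g z) a.
Proof.
  intros Hf Hg.
  destruct (analytic_tower2 f g a Hf Hg) as (F & G & d & M & K & hd & hM & hK & HF & HG & Ef & Eg).
  apply (tower_analytic _ a (fun n h => F n h + G n h) d (2 * M) K); try lra.
  - intros n h hh. destruct (HF n h hh) as [F1 F2]. destruct (HG n h hh) as [G1 G2].
    split; [rewrite F1, G1; ring|].
    eapply Rle_trans; [apply Cmod_triangle|lra].
  - intros h hh. now rewrite Ef, Eg.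
Qed.

Lemma analytic_ext (f g : C -> C) (a : C) (r : R) :
  (0 < r)%R -> (forall z, disk a r z -> f z = g z) -> analytic_at f a -> analytic_at g a.
Proof.
  intros hr E [c [s [hs H]]]. exists c, (Rmin r s).
  split; [now apply Rmin_pos|]. intros z hz. unfold disk in *.
  rewrite <- E.
  - apply H. eapply Rlt_le_trans; [exact hz|apply Rmin_r].
  - eapply Rlt_le_trans; [exact hz|apply Rmin_l].
Qed.

(* [mul_rest F G n m + F n * G m] is the n-th remainder of [F 0 * G m], by
   iterating the Leibniz rule (fg - f(0)g(0))/h = f(0) (g - g(0))/h + (f - f(0))/h g. *)
Fixpoint mul_rest (F G : nat -> C -> C) (n m : nat) (h : C) : C :=
  match n with
  | O => 0
  | S k => mul_rest F G k (S m) h + F k 0 * G (S m) h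
  end.

(** In closed form [mul_rest F G n m] is the sum over [k < n] of [F k 0 * G (n + m - k)]. The offset
    [m] shifts only the index of [G], so every summand inherits the recursion of [G]. *)
Lemma mul_rest_rec (F G : nat -> C -> C) (d M K : R) (h : C) (n m : nat) :
  tower G d M K -> (Cmod h < d)%R ->
  mul_rest F G n m h = mul_rest F G n m 0 + h * mul_rest F G n (S m) h.
Proof.
  intros HG hh. revert m. induction n as [|n IH]; intros m; simpl; [ring|].
  rewrite (IH (S m)), (proj1 (HG (S m) h hh)). ring.
Qed.

Lemma mul_rest_bound (F G : nat -> C -> C) (d M K : R) (h : C) (n m : nat) :
  (0 <= M)%R -> (0 < K)%R -> tower F d M K -> tower G d M K -> (Cmod h < d)%R ->
  (Cmod (mul_rest F G n m h) <= INR n * (M * M * K ^ (n + m)))%R.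
Proof.
  intros hM hK HF HG hh. revert m. induction n as [|n IH]; intros m.
  - simpl. rewrite Cmod_0. lra.
  - rewrite S_INR. simpl mul_rest.
    eapply Rle_trans; [apply Cmod_triangle|].
    specialize (IH (S m)). rewrite Nat.add_succ_r in IH. simpl (S n + m)%nat.
    rewrite Rmult_plus_distr_r, Rmult_1_l. apply Rplus_le_compat; [exact IH|].
    rewrite Cmod_mult.
    replace (M * M * K ^ S (n + m))%R with ((M * K ^ n) * (M * K ^ S m))%R.
    + apply Rmult_le_compat; try apply Cmod_ge_0.
      * apply (HF n 0). rewrite Cmod_0. eapply Rle_lt_trans; [apply Cmod_ge_0|exact hh].
      * apply (HG (S m) h hh).
    + rewrite <- Nat.add_succ_r, pow_add. ring.
Qed.

(** The [n]-th remainder of a product has [n + 1] summands; this absorbs their number into the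
    geometric rate, which doubles from [K] to [2 * K]. *)
Lemma INR_S_le_pow2 (n : nat) : (INR n + 1 <= 2 ^ n)%R.
Proof.
  induction n as [|n IH]; [simpl; lra|]. rewrite S_INR. simpl (2 ^ S n)%R.
  assert (k := pos_INR n). lra.
Qed.

Lemma analytic_mult (f g : C -> C) (a : C) :
  analytic_at f a -> analytic_at g a -> analytic_at (fun z => f z * g z) a.
Proof.
  intros Hf Hg.
  destruct (analytic_tower2 f g a Hf Hg) as (F & G & d & M & K & hd & hM & hK & HF & HG & Ef & Eg).
  apply (tower_analytic _ a (fun n h => mul_rest F G n 0 h + F n h * G 0%nat h)
    d (M * M) (2 * K)); try lra; [nra| |].
  - intros n h hh. destruct (HF n h hh) as [F1 F2]. destruct (HG 0%nat h hh) as [G1 G2].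
    split.
    + simpl. rewrite (mul_rest_rec F G d M K h n 0 HG hh), F1.
      replace (G 0%nat h) with (G 0%nat 0 + h * G 1%nat h) by now rewrite <- G1.
      ring.
    + eapply Rle_trans; [apply Cmod_triangle|].
      assert (B := mul_rest_bound F G d M K h n 0 hM hK HF HG hh).
      rewrite Nat.add_0_r in B.
      assert (hKn : (0 < K ^ n)%R) by now apply pow_lt.
      assert (Cmod (F n h * G 0%nat h) <= M * M * K ^ n)%R.
      { rewrite Cmod_mult. simpl in G2. rewrite Rmult_1_r in G2.
        replace (M * M * K ^ n)%R with (M * K ^ n * M)%R by ring.
        apply Rmult_le_compat; auto using Cmod_ge_0. }
      rewrite Rpow_mult_distr.
      apply Rle_trans with ((INR n + 1) * (M * M * K ^ n))%R; [lra|].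
      replace (M * M * (2 ^ n * K ^ n))%R with (2 ^ n * (M * M * K ^ n))%R by ring.
      apply Rmult_le_compat_r; [|apply INR_S_le_pow2].
      apply Rmult_le_pos; [apply Rmult_le_pos; exact hM|lra].
  - intros h hh. simpl. rewrite Ef, Eg by exact hh. ring.
Qed.

(* [inv_num F n 0 / F 0] is the n-th remainder of [1 / F 0]: writing f = c + h f_1 with
   c = f(0), the first remainder of N / f is (N_1 - (N(0) / c) f_1) / f. *)
Fixpoint inv_num (F : nat -> C -> C) (n m : nat) (h : C) : C :=
  match n with
  | O => match m with O => 1 | _ => 0 end
  | S k => inv_num F k (S m) h - inv_num F k 0 0 / F 0%nat 0 * F (S m) h
  end.

(** [inv_num F n m] is the [m]-th divided remainder of the numerator [inv_num F n 0], starting from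
    the constant 1; the next numerator is built from index [S m]. *)
Lemma inv_num_rec (F : nat -> C -> C) (d M K : R) (h : C) (n m : nat) :
  tower F d M K -> (Cmod h < d)%R ->
  inv_num F n m h = inv_num F n m 0 + h * inv_num F n (S m) h.
Proof.
  intros HF hh. revert m. induction n as [|n IH]; intros m.
  - simpl. destruct m; ring.
  - simpl. rewrite (IH (S m)), (proj1 (HF (S m) h hh)). ring.
Qed.

Lemma inv_num_bound (F : nat -> C -> C) (d M K : R) (h : C) (n m : nat) :
  (0 <= M)%R -> (0 < K)%R -> tower F d M K -> F 0%nat 0 <> 0 -> (Cmod h < d)%R ->
  (Cmod (inv_num F n m h) <= (K + K * M / Cmod (F 0%nat 0)) ^ n * K ^ m)%R.
Proof.
  intros hM hK HF hc hh.
  assert (hc' : (0 < Cmod (F 0%nat 0))%R) by now apply Cmod_gt_0.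
  (* One more division costs a factor [K] for the raised index [m], plus [K * M / Cmod (F 0 0)] for
     the subtracted multiple of [F (S m)]. *)
  set (L := (K + K * M / Cmod (F 0%nat 0))%R).
  assert (hL : (0 < L)%R).
  { unfold L. assert (0 <= K * M / Cmod (F 0%nat 0))%R; [|lra].
    apply Rdiv_le_0_compat; [nra|exact hc']. }
  revert m h hh. induction n as [|n IH]; intros m h hh.
  - simpl. rewrite Rmult_1_l. destruct m; [rewrite Cmod_1; simpl; lra|].
    rewrite Cmod_0. apply pow_le. lra.
  - simpl inv_num. unfold Cminus.
    eapply Rle_trans; [apply Cmod_triangle|].
    rewrite Cmod_opp, Cmod_mult, Cmod_div by exact hc.
    assert (h0 : (Cmod 0 < d)%R)
      by (rewrite Cmod_0; eapply Rle_lt_trans; [apply Cmod_ge_0|exact hh]).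
    assert (I1 := IH (S m) h hh). assert (I2 := IH 0%nat 0 h0).
    rewrite pow_O, Rmult_1_r in I2.
    destruct (HF (S m) h hh) as [_ F2].
    assert (I3 : (Cmod (inv_num F n 0 0) / Cmod (F 0%nat 0) * Cmod (F (S m) h)
      <= L ^ n / Cmod (F 0%nat 0) * (M * K ^ S m))%R).
    { apply Rmult_le_compat; auto using Cmod_ge_0.
      - apply Rdiv_le_0_compat; [apply Cmod_ge_0|exact hc'].
      - apply Rmult_le_compat_r; [|exact I2]. left. now apply Rinv_0_lt_compat. }
    replace (L ^ S n * K ^ m)%R
      with (L ^ n * K ^ S m + L ^ n / Cmod (F 0%nat 0) * (M * K ^ S m))%R; [lra|].
    simpl. unfold L at 3. field. lra.
Qed.

Lemma analytic_inv (f : C -> C) (a : C) :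
  analytic_at f a -> f a <> 0 -> analytic_at (fun z => / f z) a.
Proof.
  intros Hf hfa.
  destruct (analytic_tower f a Hf) as (F & d & M & K & hd & hM & hK & HF & Ef).
  assert (hc : F 0%nat 0 <> 0).
  { rewrite Ef by (rewrite Cmod_0; lra). now replace (a + 0) with a by ring. }
  set (m0 := Cmod (F 0%nat 0)).
  assert (hm0 : (0 < m0)%R) by now apply Cmod_gt_0.
  assert (hMK : (0 <= M * K)%R) by nra.
  (* Since [Cmod (F 1 h) <= M * K], this radius changes [F 0] by at most [m0 / 2], so its modulus
     stays above [m0 / 2]; hence the constant [2 / m0] below. *)
  set (d' := Rmin d (m0 / (2 * (M * K + 1)))).
  assert (hd' : (0 < d')%R).
  { apply Rmin_pos; [exact hd|]. apply Rdiv_lt_0_compat; lra. }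
  assert (hlow : forall h, (Cmod h < d')%R -> (m0 / 2 <= Cmod (F 0%nat h))%R).
  { intros h hh. assert (hh1 : (Cmod h < d)%R) by (eapply Rlt_le_trans; [exact hh|apply Rmin_l]).
    assert (hh2 : (Cmod h < m0 / (2 * (M * K + 1)))%R)
      by (eapply Rlt_le_trans; [exact hh|apply Rmin_r]).
    assert (hh3 : (Cmod h * (M * K) <= m0 / 2)%R).
    { apply Rle_trans with (m0 / (2 * (M * K + 1)) * (M * K + 1))%R.
      - apply Rmult_le_compat; try lra. apply Cmod_ge_0.
      - right. field. lra. }
    destruct (HF 1%nat h hh1) as [_ B]. rewrite pow_1 in B.
    assert (Cmod (h * F 1%nat h) <= m0 / 2)%R.
    { rewrite Cmod_mult. eapply Rle_trans; [|exact hh3].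
      apply Rmult_le_compat_l; [apply Cmod_ge_0|exact B]. }
    assert (m0 <= Cmod (F 0%nat h) + Cmod (h * F 1%nat h))%R; [|lra].
    unfold m0. rewrite <- (Cmod_opp (h * _)).
    replace (F 0%nat 0) with (F 0%nat h + - (h * F 1%nat h))
      by (rewrite (proj1 (HF 0%nat h hh1)); ring).
    apply Cmod_triangle. }
  assert (hdd : (d' <= d)%R) by apply Rmin_l.
  assert (hnz : forall h, (Cmod h < d')%R -> F 0%nat h <> 0).
  { intros h hh. apply Cmod_gt_0. specialize (hlow h hh). lra. }
  apply (tower_analytic _ a (fun n h => inv_num F n 0 h / F 0%nat h) d' (2 / m0)
    (K + K * M / m0)).
  - exact hd'.
  - left. apply Rdiv_lt_0_compat; lra.
  - assert (0 <= K * M / m0)%R by (apply Rdiv_le_0_compat; nra). lra.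
  - intros n h hh. assert (hh1 : (Cmod h < d)%R) by lra. specialize (hnz h hh). split.
    + simpl. rewrite (inv_num_rec F d M K h n 0 HF hh1).
      assert (E := proj1 (HF 0%nat h hh1)).
      apply (f_equal (fun x => x / F 0%nat h)) in E.
      replace (F 0%nat h / F 0%nat h) with (RtoC 1) in E by (field; exact hnz).
      (* The intermediate expression isolates [(F 0 0 + h * F 1 h) / F 0 h], which equals 1 by the
         tower relation; what remains on either side is a field identity. *)
      transitivity (inv_num F n 0 0 / F 0%nat 0 * 1 + h * inv_num F n 1 h / F 0%nat h
        + inv_num F n 0 0 / F 0%nat 0 * ((F 0%nat 0 + h * F 1%nat h) / F 0%nat h - 1
        - h * F 1%nat h / F 0%nat h)).
      * field. now split.
      * rewrite <- E. field. now split.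
    + rewrite Cmod_div by exact hnz.
      assert (B := inv_num_bound F d M K h n 0 hM hK HF hc hh1).
      rewrite pow_O, Rmult_1_r in B. fold m0 in B.
      specialize (hlow h hh).
      unfold Rdiv at 1. rewrite Rmult_comm.
      apply Rmult_le_compat; auto using Cmod_ge_0.
      * left. apply Rinv_0_lt_compat. lra.
      * replace (2 / m0)%R with (/ (m0 / 2))%R by (field; lra).
        apply Rinv_le_contravar; lra.
  - intros h hh. simpl. rewrite Ef by lra. unfold Cdiv. ring.
Qed.

Lemma analytic_minus (f g : C -> C) (a : C) :
  analytic_at f a -> analytic_at g a -> analytic_at (fun z => f z - g z) a.
Proof.
  intros Hf Hg.
  apply (analytic_ext (fun z => f z + (-(1)) * g z) _ a 1); [lra|intros; ring|].
  apply analytic_plus; [exact Hf|]. apply analytic_mult; [apply analytic_const|exact Hg].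
Qed.

Lemma analytic_div (f g : C -> C) (a : C) :
  analytic_at f a -> analytic_at g a -> g a <> 0 -> analytic_at (fun z => f z / g z) a.
Proof.
  intros Hf Hg hg. apply analytic_mult; [exact Hf|]. now apply analytic_inv.
Qed.

(** Removable singularities: dropping the first entry of a tower leaves a tower with bound [M * K],
    so the difference quotient extends analytically over [a]. *)
Lemma analytic_quotient (f : C -> C) (a : C) :
  analytic_at f a ->
  exists (q : C -> C) (r : R), (0 < r)%R /\ analytic_at q a /\
    forall z, disk a r z -> f z = f a + (z - a) * q z.
Proof.
  intros Hf.
  destruct (analytic_tower f a Hf) as (F & d & M & K & hd & hM & hK & HF & Ef).
  exists (fun z => F 1%nat (z - a)), d. split; [exact hd|]. split.
  - apply (tower_analytic _ a (fun n => F (S n)) d (M * K) K); try lra; [nra| |].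
    + intros n h hh. destruct (HF (S n) h hh) as [H1 H2]. split; [exact H1|].
      simpl in H2. rewrite Rmult_assoc. exact H2.
    + intros h _. f_equal. ring.
  - intros z hz. unfold disk in hz.
    assert (E := proj1 (HF 0%nat _ hz)). rewrite !Ef in E; [| rewrite Cmod_0; lra |exact hz].
    replace (a + (z - a)) with z in E by ring. now replace (a + 0) with a in E by ring.
Qed.

Lemma analytic_continuous (f : C -> C) (a : C) (eps : R) :
  analytic_at f a -> (0 < eps)%R ->
  exists r, (0 < r)%R /\ forall z, disk a r z -> (Cmod (f z - f a) < eps)%R.
Proof.
  intros Hf he.
  destruct (analytic_tower f a Hf) as (F & d & M & K & hd & hM & hK & HF & Ef).
  assert (hMK : (0 <= M * K)%R) by nra.
  exists (Rmin d (eps / (M * K + 1))). split.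
  { apply Rmin_pos; [exact hd|]. apply Rdiv_lt_0_compat; lra. }
  intros z hz. unfold disk in hz.
  assert (h1 : (Cmod (z - a) < d)%R) by (eapply Rlt_le_trans; [exact hz|apply Rmin_l]).
  assert (h2 : (Cmod (z - a) < eps / (M * K + 1))%R)
    by (eapply Rlt_le_trans; [exact hz|apply Rmin_r]).
  assert (E := proj1 (HF 0%nat _ h1)). rewrite !Ef in E; [| rewrite Cmod_0; lra |exact h1].
  replace (a + (z - a)) with z in E by ring. replace (a + 0) with a in E by ring.
  rewrite E. replace (f a + (z - a) * F 1%nat (z - a) - f a) with ((z - a) * F 1%nat (z - a)) by ring.
  rewrite Cmod_mult. destruct (HF 1%nat _ h1) as [_ B]. rewrite pow_1 in B.
  apply Rle_lt_trans with (Cmod (z - a) * (M * K))%R.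
  - apply Rmult_le_compat_l; [apply Cmod_ge_0|exact B].
  - assert (E2 : (eps = eps / (M * K + 1) * (M * K + 1))%R) by (field; lra).
    assert (k := Cmod_ge_0 (z - a)). nra.
Qed.

(** * The maximum principle *)

Lemma unit_angle (x y : R) :
  (x ^ 2 + y ^ 2 = 1)%R -> exists t, x = cos t /\ y = sin t.
Proof.
  intros H. assert (hx : (-1 <= x <= 1)%R) by nra.
  assert (hs : (sin (acos x) = Rabs y)%R).
  { rewrite sin_acos by exact hx. rewrite <- sqrt_Rsqr_abs. f_equal. unfold Rsqr. lra. }
  destruct (Rle_dec 0 y) as [hy|hy].
  - exists (acos x). rewrite cos_acos by exact hx. rewrite hs, Rabs_pos_eq; auto.
  - exists (- acos x)%R. rewrite cos_neg, sin_neg, cos_acos by exact hx.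
    rewrite hs, Rabs_left by lra. split; [reflexivity|ring].
Qed.

Lemma de_moivre (t : R) (k : nat) : (cos t, sin t) ^ k = (cos (INR k * t), sin (INR k * t)).
Proof.
  induction k as [|k IH].
  - simpl. now rewrite Rmult_0_l, cos_0, sin_0.
  - rewrite Cpow_S, IH, S_INR.
    replace ((INR k + 1) * t)%R with (t + INR k * t)%R by ring.
    rewrite cos_plus, sin_plus. unfold Cmult; simpl. f_equal; ring.
Qed.

Lemma unimodular_root (w : C) (k : nat) :
  Cmod w = 1%R -> (0 < k)%nat -> exists u, Cmod u = 1%R /\ u ^ k = w.
Proof.
  intros hw hk. destruct w as [x y].
  assert (H : (x ^ 2 + y ^ 2 = 1)%R).
  { assert (E := Cmod2_alt (x, y)). rewrite hw in E. simpl in *. lra. }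
  destruct (unit_angle x y H) as [t [-> ->]].
  exists (cos (t / INR k), sin (t / INR k)). split.
  - unfold Cmod. simpl fst; simpl snd.
    rewrite <- !Rsqr_pow2, Rplus_comm, sin2_cos2. apply sqrt_1.
  - rewrite de_moivre. assert (INR k <> 0%R) by (apply not_0_INR; lia).
    replace (INR k * (t / INR k))%R with t by (field; assumption). reflexivity.
Qed.

Lemma tower_at_0 (F : nat -> C -> C) (d M K : R) (h : C) (k : nat) :
  tower F d M K -> (Cmod h < d)%R -> (forall j, (1 <= j <= k)%nat -> F j 0 = 0) ->
  F 0%nat h = F 0%nat 0 + h ^ S k * F (S k) h.
Proof.
  intros HF hh. induction k as [|k IH]; intros hz.
  - rewrite (proj1 (HF 0%nat h hh)). simpl. ring.
  - rewrite IH by (intros j hj; apply hz; lia).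
    rewrite (proj1 (HF (S k) h hh)), (hz (S k)) by lia. simpl. ring.
Qed.

(* If c_k is the first nonzero Taylor coefficient of positive index, moving from [a] in a
   direction [u] where c_k u^k is a positive multiple of [f a] increases the modulus. *)
Lemma local_max_locally_constant (f : C -> C) (a : C) (r : R) :
  analytic_at f a -> (0 < r)%R ->
  (forall z, disk a r z -> (Cmod (f z) <= Cmod (f a))%R) ->
  exists s, (0 < s)%R /\ forall z, disk a s z -> f z = f a.
Proof.
  intros Hf hr Hmax.
  destruct (Ceq_dec (f a) 0) as [h0|h0].
  { exists r. split; [exact hr|]. intros z hz. specialize (Hmax z hz).
    rewrite h0, Cmod_0 in *. apply Cmod_eq_0. assert (k := Cmod_ge_0 (f z)). lra. }
  destruct (analytic_tower f a Hf) as (F & d & M & K & hd & hM & hK & HF & Ef).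
  assert (E0 : F 0%nat 0 = f a).
  { rewrite Ef by (rewrite Cmod_0; lra). f_equal. ring. }
  destruct (classic (exists k, F (S k) 0 <> 0)) as [Hex|Hall].
  - exfalso.
    assert (Hmin : exists k, F (S k) 0 <> 0 /\ forall j, (1 <= j <= k)%nat -> F j 0 = 0).
    { destruct (dec_inh_nat_subset_has_unique_least_element (fun k => F (S k) 0 <> 0)
        (fun k => classic _) Hex) as [k [[hk hleast] _]].
      exists k. split; [exact hk|]. intros j hj.
      apply NNPP. intros hne. destruct j as [|j]; [lia|].
      specialize (hleast j hne). lia. }
    destruct Hmin as [k [hk hz]].
    set (c := F (S k) 0) in *.
    assert (hc : (0 < Cmod c)%R) by now apply Cmod_gt_0.
    assert (ha : (0 < Cmod (f a))%R) by now apply Cmod_gt_0.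
    (* Here [c * u ^ S k] is [f a] times the positive number [Cmod c / Cmod (f a)], so the leading
       term points along [f a]. *)
    destruct (unimodular_root ((f a / c) * RtoC (Cmod c / Cmod (f a))) (S k)) as [u [hu huk]];
      [|lia|].
    { rewrite Cmod_mult, Cmod_div by exact hk. rewrite Cmod_R, Rabs_pos_eq.
      - field. lra.
      - left. apply Rdiv_lt_0_compat; lra. }
    set (L := (M * K ^ S (S k))%R).
    assert (hL : (0 <= L)%R) by (apply Rmult_le_pos; [lra|apply pow_le; lra]).
    (* With [s * (L + 1) < Cmod c] the remainder, at most [s ^ S k * (s * L)], is smaller than the
       gain [s ^ S k * Cmod c]; halving makes all the bounds strict. *)
    set (s := (Rmin (Rmin d r) (Cmod c / (L + 1)) / 2)%R).
    assert (hs0 : (0 < Rmin (Rmin d r) (Cmod c / (L + 1)))%R).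
    { repeat apply Rmin_pos; try lra. apply Rdiv_lt_0_compat; lra. }
    assert (hs1 := Rmin_l (Rmin d r) (Cmod c / (L + 1))).
    assert (hs2 := Rmin_r (Rmin d r) (Cmod c / (L + 1))).
    assert (hs3 := Rmin_l d r). assert (hs4 := Rmin_r d r).
    assert (hs : (0 < s < d /\ s < r /\ s < Cmod c / (L + 1))%R) by (unfold s; lra).
    set (h := RtoC s * u).
    assert (hh : Cmod h = s).
    { unfold h. rewrite Cmod_mult, hu, Cmod_R, Rabs_pos_eq by lra. ring. }
    assert (E : f (a + h) = f a + h ^ S k * c + h ^ S (S k) * F (S (S k)) h).
    { rewrite <- Ef by lra. rewrite (tower_at_0 F d M K h k HF ltac:(lra) hz), E0.
      rewrite (proj1 (HF (S k) h ltac:(lra))). fold c. simpl. ring. }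
    assert (E2 : h ^ S k * c = RtoC (s ^ S k * (Cmod c / Cmod (f a))) * f a).
    { unfold h. rewrite Cpow_mult_l, huk, RtoC_mult, RtoC_pow. field. exact hk. }
    assert (hsk : (0 < s ^ S k)%R) by (apply pow_lt; lra).
    assert (E3 : Cmod (f a + h ^ S k * c) = (Cmod (f a) + s ^ S k * Cmod c)%R).
    { rewrite E2.
      replace (f a + RtoC (s ^ S k * (Cmod c / Cmod (f a))) * f a)
        with (RtoC (1 + s ^ S k * (Cmod c / Cmod (f a))) * f a) by (rewrite RtoC_plus; ring).
      rewrite Cmod_mult, Cmod_R, Rabs_pos_eq.
      - field. lra.
      - assert (0 < Cmod c / Cmod (f a))%R by (apply Rdiv_lt_0_compat; lra). nra. }
    assert (E4 : (Cmod (h ^ S (S k) * F (S (S k)) h) <= s ^ S k * (s * L))%R).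
    { rewrite Cmod_mult, Cmod_pow, hh.
      replace (s ^ S k * (s * L))%R with (s ^ S (S k) * L)%R by (simpl; ring).
      apply Rmult_le_compat_l; [apply pow_le; lra|]. apply HF. lra. }
    assert (E5 : (s * L < Cmod c)%R).
    { apply Rle_lt_trans with (s * (L + 1))%R; [nra|].
      replace (Cmod c) with (Cmod c / (L + 1) * (L + 1))%R by (field; lra).
      apply Rmult_lt_compat_r; lra. }
    assert (E6 : (Cmod (f (a + h)%C) <= Cmod (f a))%R).
    { apply Hmax. unfold disk. replace (a + h - a) with h by ring. lra. }
    assert (E7 : (Cmod (f a + h ^ S k * c) <= Cmod (f (a + h)%C) +
      Cmod (h ^ S (S k) * F (S (S k)) h))%R).
    { rewrite E. rewrite <- (Cmod_opp (h ^ S (S k) * _)).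
      eapply Rle_trans; [|apply Cmod_triangle]. right. f_equal. ring. }
    assert (s ^ S k * (s * L) < s ^ S k * Cmod c)%R by (apply Rmult_lt_compat_l; lra).
    lra.
  (* All Taylor coefficients of positive index vanish, so [f z - f a] is its own remainder of every
     order and is at most [M * (/ 2) ^ S k] for all [k]. *)
  - assert (Hz : forall j, (1 <= j)%nat -> F j 0 = 0).
    { intros j hj. apply NNPP. intros hne. apply Hall. destruct j as [|j]; [lia|now exists j]. }
    exists (Rmin d (/ (2 * K))). split.
    { apply Rmin_pos; [exact hd|]. apply Rinv_0_lt_compat. lra. }
    intros z hz. unfold disk in hz. set (h := z - a) in *.
    assert (hd' : (Cmod h < d)%R) by (eapply Rlt_le_trans; [exact hz|apply Rmin_l]).
    assert (hK' : (K * Cmod h <= / 2)%R).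
    { assert (Cmod h < / (2 * K))%R by (eapply Rlt_le_trans; [exact hz|apply Rmin_r]).
      apply Rle_trans with (K * / (2 * K))%R; [apply Rmult_le_compat_l; lra|].
      right. field. lra. }
    assert (Ez : f z = F 0%nat h) by (rewrite Ef by exact hd'; f_equal; unfold h; ring).
    assert (B : forall k, (Cmod (f z - f a) <= M * (/ 2) ^ S k)%R).
    { intros k. rewrite Ez, (tower_at_0 F d M K h k HF hd'), E0 by (intros; apply Hz; lia).
      replace (f a + h ^ S k * F (S k) h - f a) with (h ^ S k * F (S k) h) by ring.
      rewrite Cmod_mult, Cmod_pow.
      apply Rle_trans with (Cmod h ^ S k * (M * K ^ S k))%R.
      - apply Rmult_le_compat_l; [apply pow_le, Cmod_ge_0|]. now apply HF.
      - replace (Cmod h ^ S k * (M * K ^ S k))%R with (M * (K * Cmod h) ^ S k)%R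
          by (rewrite Rpow_mult_distr; ring).
        apply Rmult_le_compat_l; [exact hM|]. apply pow_incr. split; [|exact hK'].
        apply Rmult_le_pos; [lra|apply Cmod_ge_0]. }
    apply Ceq_minus, Cmod_eq_0. apply Rle_antisym; [|apply Cmod_ge_0].
    apply Rnot_lt_le. intros hpos.
    destruct (pow_lt_1_zero (/ 2) ltac:(rewrite Rabs_pos_eq; lra)
      (Cmod (f z - f a) / (M + 1))%R ltac:(apply Rdiv_lt_0_compat; lra)) as [N HN].
    specialize (HN (S N) ltac:(lia)). specialize (B N).
    assert (hp : (0 < (/ 2) ^ S N)%R) by (apply pow_lt; lra).
    rewrite Rabs_pos_eq in HN by lra.
    assert (E : (Cmod (f z - f a) = Cmod (f z - f a) / (M + 1) * (M + 1))%R) by (field; lra).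
    nra.
Qed.

Definition segment (p q : C) (t : R) : C := p + RtoC t * (q - p).

Lemma segment_dist (p q : C) (s t : R) :
  Cmod (segment p q s - segment p q t) = (Rabs (s - t) * Cmod (q - p))%R.
Proof.
  unfold segment.
  replace (p + RtoC s * (q - p) - (p + RtoC t * (q - p))) with (RtoC (s - t) * (q - p))
    by (rewrite RtoC_minus; ring).
  now rewrite Cmod_mult, Cmod_R.
Qed.

(** Connectedness of [0, 1]: let [T] be the supremum of the times up to which [f] keeps its initial
    value. Continuity gives this value at [T], and local constancy at a maximum pushes past any
    [T < 1]. The maximum is not asked for at [t = 1], so [q] may lie on a boundary circle. *)
Lemma constant_along_segment (f : C -> C) (p q : C) :
  (forall t, (0 <= t <= 1)%R -> analytic_at f (segment p q t)) ->
  (forall t, (0 <= t < 1)%R -> exists r, (0 < r)%R /\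
     forall z, disk (segment p q t) r z -> (Cmod (f z) <= Cmod (f p))%R) ->
  f q = f p.
Proof.
  intros Han Hmax.
  set (E := fun t => (0 <= t <= 1)%R /\ forall s, (0 <= s <= t)%R -> f (segment p q s) = f p).
  assert (P0 : segment p q 0 = p) by (unfold segment; ring).
  assert (P1 : segment p q 1 = q) by (unfold segment; ring).
  assert (E0 : E 0%R).
  { split; [lra|]. intros s hs. replace s with 0%R by lra. now rewrite P0. }
  destruct (completeness E) as [T [Tub Tlub]].
  { exists 1%R. intros t [ht _]. lra. }
  { now exists 0%R. }
  assert (hT0 : (0 <= T)%R) by now apply Tub.
  assert (hT1 : (T <= 1)%R) by (apply Tlub; intros t [ht _]; lra).
  set (D := Cmod (q - p)). assert (hD : (0 <= D)%R) by apply Cmod_ge_0.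
  assert (below : forall s, (0 <= s < T)%R -> f (segment p q s) = f p).
  { intros s hs. apply NNPP. intros hne.
    assert (T <= s)%R; [|lra]. apply Tlub. intros t [ht Ht].
    apply Rnot_lt_le. intros hst. apply hne, Ht. lra. }
  assert (atT : f (segment p q T) = f p).
  { destruct (Req_dec T 0) as [->|hT]; [now rewrite P0|].
    apply NNPP. intros hne.
    assert (he : (0 < Cmod (f p - f (segment p q T)))%R).
    { apply Cmod_gt_0. intros k. apply Ceq_minus in k. now apply hne. }
    destruct (analytic_continuous f _ _ (Han T ltac:(lra)) he) as [r [hr Hr]].
    (* A time just before [T] whose point is within [r] of the point at [T]; [D + 1] keeps the
       divisor positive when [p = q]. *)
    set (s := Rmax 0 (T - r / (2 * (D + 1)))).
    assert (hq : (0 < r / (2 * (D + 1)))%R) by (apply Rdiv_lt_0_compat; lra).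
    assert (hs : (0 <= s < T)%R).
    { split; [apply Rmax_l|]. apply Rmax_lub_lt; lra. }
    specialize (Hr (segment p q s)). rewrite below in Hr by exact hs.
    apply (Rlt_irrefl (Cmod (f p - f (segment p q T)))), Hr.
    unfold disk. rewrite segment_dist. fold D.
    assert (h2 : (T - r / (2 * (D + 1)) <= s)%R) by apply Rmax_r.
    rewrite Rabs_left by lra.
    assert (Er : (r = 2 * (r / (2 * (D + 1)) * (D + 1)))%R) by (field; lra).
    nra. }
  destruct (Req_dec T 1) as [->|hT]; [now rewrite <- P1|].
  exfalso.
  destruct (Hmax T ltac:(lra)) as [r [hr Hr]]. rewrite <- atT in Hr.
  destruct (local_max_locally_constant f _ r (Han T ltac:(lra)) hr Hr) as [s [hs Hs]].
  assert (hq : (0 < s / (2 * (D + 1)))%R) by (apply Rdiv_lt_0_compat; lra).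
  set (T' := Rmin 1 (T + s / (2 * (D + 1)))).
  assert (h1 : (T' <= 1)%R) by apply Rmin_l.
  assert (h2 : (T' <= T + s / (2 * (D + 1)))%R) by apply Rmin_r.
  assert (h3 : (T < T')%R) by (apply Rmin_glb_lt; lra).
  assert (ET' : E T').
  { split; [lra|]. intros u hu. destruct (Rlt_dec u T) as [hlt|hge]; [apply below; lra|].
    rewrite Hs; [exact atT|]. unfold disk. rewrite segment_dist. fold D.
    rewrite Rabs_pos_eq by lra.
    assert (Es : (s = 2 * (s / (2 * (D + 1)) * (D + 1)))%R) by (field; lra).
    nra. }
  specialize (Tub _ ET'). lra.
Qed.

(** * Attainment of maxima on closed disks *)

Lemma Cmod_le_abs (x y : R) : (Cmod (x, y) <= Rabs x + Rabs y)%R.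
Proof.
  assert (E := Cmod2_alt (x, y)). simpl Re in E; simpl Im in E.
  rewrite <- (pow2_abs x), <- (pow2_abs y) in E.
  assert (h1 := Rabs_pos x). assert (h2 := Rabs_pos y). assert (h3 := Cmod_ge_0 (x, y)). nra.
Qed.

Lemma im_le_Cmod (z : C) : (Rabs (Im z) <= Cmod z)%R.
Proof. eapply Rle_trans; [apply Rmax_r|apply Rmax_Cmod]. Qed.

(** If no maximum exists, each point of the disk has a neighborhood on which [phi] stays below some
    value [phi q]. Finitely many neighborhoods cover the disk, and the best of their [q] lies in one
    of them, so its value would be below a value that it dominates. *)
Lemma closed_disk_max (phi : C -> R) (r : R) :
  (0 <= r)%R ->
  (forall p eps, (Cmod p <= r)%R -> (0 < eps)%R -> exists d, (0 < d)%R /\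
     forall z, disk p d z -> (phi z < phi p + eps)%R) ->
  exists p, (Cmod p <= r)%R /\ forall z, (Cmod z <= r)%R -> (phi z <= phi p)%R.
Proof.
  intros hr Hc. apply NNPP. intros Hno.
  assert (h0 : (Cmod 0 <= r)%R) by (rewrite Cmod_0; exact hr).
  assert (H : forall p : C, exists dq : R * C, (0 < fst dq)%R /\ (Cmod (snd dq) <= r)%R /\
    forall z, (Cmod z <= r)%R -> disk p (fst dq) z -> (phi z < phi (snd dq))%R).
  { intros p. destruct (Rle_dec (Cmod p) r) as [hp|hp].
    - assert (Hq : exists q, (Cmod q <= r)%R /\ (phi p < phi q)%R).
      { apply NNPP. intros k. apply Hno. exists p. split; [exact hp|].
        intros z hz. apply Rnot_lt_le. intros hlt. apply k. now exists z. }
      destruct Hq as [q [hq1 hq2]].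
      destruct (Hc p (phi q - phi p)%R hp ltac:(lra)) as [d [hd Hd]].
      exists (d, q). simpl. repeat split; auto. intros z _ hz. specialize (Hd z hz). lra.
    (* The covering is of the square [-r, r]^2; a point outside the disk gets a radius that misses
       the disk, so the last condition holds vacuously. *)
    - exists ((Cmod p - r)%R, RtoC 0). simpl. repeat split; [lra|exact h0|].
      intros z hz hzp. exfalso. unfold disk in hzp.
      assert (Cmod p <= Cmod z + Cmod (z - p))%R; [|lra].
      rewrite <- (Cmod_opp (z - p)). replace p with (z + - (z - p)) at 1 by ring.
      apply Cmod_triangle. }
  assert (H' : forall p : C, {dq : R * C | (0 < fst dq)%R /\ (Cmod (snd dq) <= r)%R /\
    forall z, (Cmod z <= r)%R -> disk p (fst dq) z -> (phi z < phi (snd dq))%R}).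
  { intros p. apply constructive_indefinite_description, H. }
  clear H. set (dq := fun p => proj1_sig (H' p)).
  assert (Hdq : forall p, (0 < fst (dq p))%R /\ (Cmod (snd (dq p)) <= r)%R /\
    forall z, (Cmod z <= r)%R -> disk p (fst (dq p)) z -> (phi z < phi (snd (dq p)))%R).
  { intros p. exact (proj2_sig (H' p)). }
  clearbody dq. clear H'.
  set (pt := fun t : Compactness.Tn 2 R => (fst t, fst (snd t)) : C).
  (* The cover consists of coordinate boxes: two coordinates within half the radius keep the modulus
     within the radius. *)
  assert (hhalf : forall t, (0 < fst (dq (pt t)) / 2)%R).
  { intros t. destruct (Hdq (pt t)) as [k _]. lra. }
  apply (compactness_list 2 ((- r)%R, ((- r)%R, tt)) (r, (r, tt))
    (fun t => mkposreal _ (hhalf t))).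
  intros [l Hl].
  assert (Hbest : exists q, (Cmod q <= r)%R /\
    forall t, In t l -> (phi (snd (dq (pt t))) <= phi q)%R).
  { clear Hl. induction l as [|t l [q [hq IH]]].
    - exists 0. split; [exact h0|]. intros t [].
    - destruct (Hdq (pt t)) as [_ [hqt _]].
      destruct (Rle_dec (phi (snd (dq (pt t)))) (phi q)) as [hle|hgt].
      + exists q. split; [exact hq|]. intros t' [<-|ht']; auto.
      + exists (snd (dq (pt t))). split; [exact hqt|]. intros t' [<-|ht']; [lra|].
        specialize (IH t' ht'). lra. }
  destruct Hbest as [q [hq Hq]].
  assert (b1 := re_le_Cmod q). assert (b2 := im_le_Cmod q).
  destruct (Hl (Re q, (Im q, tt))) as [t [hin [_ hcl]]].
  { assert (b3 := Rle_trans _ _ _ b1 hq). assert (b4 := Rle_trans _ _ _ b2 hq).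
    apply Rabs_le_between in b3. apply Rabs_le_between in b4. simpl. tauto. }
  destruct t as [u [v []]]. simpl in hcl. destruct hcl as [c1 [c2 _]].
  specialize (Hq _ hin). destruct (Hdq (pt (u, (v, tt)))) as [_ [_ Hz]].
  apply (Rle_not_lt _ _ Hq). apply Hz; [exact hq|]. unfold disk.
  replace (q - pt (u, (v, tt))) with ((Re q - u)%R, (Im q - v)%R)
    by (destruct q; reflexivity).
  eapply Rle_lt_trans; [apply Cmod_le_abs|]. unfold pt in *. simpl in *. lra.
Qed.

Lemma unit_disk_Cmod (z : C) : unit_disk z <-> (Cmod z < 1)%R.
Proof. unfold unit_disk, disk. now replace (z - 0) with z by ring. Qed.

Lemma segment_Cmod (p q : C) (t : R) :
  (0 <= t <= 1)%R -> (Cmod (segment p q t) <= (1 - t) * Cmod p + t * Cmod q)%R.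
Proof.
  intros ht. unfold segment.
  replace (p + RtoC t * (q - p)) with (RtoC (1 - t) * p + RtoC t * q)
    by (rewrite RtoC_minus; ring).
  eapply Rle_trans; [apply Cmod_triangle|].
  rewrite !Cmod_mult, !Cmod_R, !Rabs_pos_eq by lra. lra.
Qed.

(** [Cmod f] attains its maximum at some [p]. Unless [p] is on the circle, [f] is constant along the
    segment from [p] to the point [r] of the circle, since every earlier point of the segment is
    interior. *)
Lemma maximum_principle (f : C -> C) (r m : R) :
  (forall a, unit_disk a -> analytic_at f a) -> (0 <= r < 1)%R ->
  (forall z, Cmod z = r -> (Cmod (f z) <= m)%R) ->
  forall z, (Cmod z <= r)%R -> (Cmod (f z) <= m)%R.
Proof.
  intros Hf hr Hb.
  assert (Hin : forall p, (Cmod p <= r)%R -> analytic_at f p).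
  { intros p hp. apply Hf, unit_disk_Cmod. lra. }
  destruct (closed_disk_max (fun z => Cmod (f z)) r ltac:(lra)) as [p [hp Hp]].
  { intros p eps hp he. destruct (analytic_continuous f p eps (Hin p hp) he) as [d [hd Hd]].
    exists d. split; [exact hd|]. intros z hz. specialize (Hd z hz).
    replace (f z) with (f z - f p + f p) by ring.
    eapply Rle_lt_trans; [apply Cmod_triangle|]. lra. }
  assert (Hpm : (Cmod (f p) <= m)%R).
  { destruct (Req_dec (Cmod p) r) as [He|Hne]; [now apply Hb|].
    assert (hq : Cmod (RtoC r) = r) by (rewrite Cmod_R, Rabs_pos_eq; lra).
    rewrite <- (constant_along_segment f p (RtoC r)); [now apply Hb| |].
    - intros t ht. apply Hin. eapply Rle_trans; [apply segment_Cmod, ht|]. rewrite hq.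
      assert (k := Cmod_ge_0 p). nra.
    - intros t ht. set (g := segment p (RtoC r) t).
      assert (hg : (Cmod g < r)%R).
      { eapply Rle_lt_trans; [apply segment_Cmod; lra|]. rewrite hq.
        assert (Cmod p < r)%R by lra. nra. }
      exists (r - Cmod g)%R. split; [lra|]. intros z hz. apply Hp. unfold disk in hz.
      replace z with (z - g + g) by ring.
      eapply Rle_trans; [apply Cmod_triangle|]. lra. }
  intros z hz. eapply Rle_trans; [apply Hp, hz|exact Hpm].
Qed.

Lemma schur_unimodular_value (f : C -> C) (p : C) :
  schur f -> unit_disk p -> Cmod (f p) = 1%R ->
  forall z, unit_disk z -> f z = f p.
Proof.
  intros [Hf Hb] hp h1 z hz. rewrite unit_disk_Cmod in hp, hz.
  assert (Hs : forall t, (0 <= t <= 1)%R -> (Cmod (segment p z t) < 1)%R).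
  { intros t ht. eapply Rle_lt_trans; [apply segment_Cmod, ht|].
    apply Rle_lt_trans with (Rmax (Cmod p) (Cmod z)); [|apply Rmax_lub_lt; assumption].
    assert (h2 := Rmax_l (Cmod p) (Cmod z)). assert (h3 := Rmax_r (Cmod p) (Cmod z)). nra. }
  apply constant_along_segment.
  - intros t ht. apply Hf, unit_disk_Cmod, Hs, ht.
  - intros t ht. specialize (Hs t ltac:(lra)). set (g := segment p z t) in *.
    exists (1 - Cmod g)%R. split; [lra|]. intros w hw. rewrite h1. apply Hb, unit_disk_Cmod.
    unfold disk in hw. replace w with (w - g + g) by ring.
    eapply Rle_lt_trans; [apply Cmod_triangle|]. lra.
Qed.

(** * The operator Delta on the Schur class *)

Lemma derive_of_quotient (f q : C -> C) (a : C) (r : R) :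
  (0 < r)%R -> analytic_at q a ->
  (forall z, disk a r z -> f z = f a + (z - a) * q z) -> C_derive f a = q a.
Proof.
  intros hr Hq E. apply is_C_lim_unique. intros P [eps HP].
  destruct (analytic_continuous q a eps Hq (cond_pos eps)) as [d [hd Hd]].
  (* Balls of the product structure on [C] are squares; the half converts coordinate bounds into a
     bound on the modulus. *)
  assert (hm : (0 < Rmin r d / 2)%R) by (assert (0 < Rmin r d)%R by (apply Rmin_pos; lra); lra).
  exists (mkposreal _ hm). intros z hz hza.
  assert (hz' : (Cmod (z - a) < Rmin r d)%R).
  { destruct hz as [h1 h2]. unfold ball in h1, h2; simpl in h1, h2.
    unfold AbsRing_ball, abs, minus, plus, opp in h1, h2; simpl in h1, h2.
    replace (z - a) with ((fst z + - fst a)%R, (snd z + - snd a)%R) by reflexivity.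
    eapply Rle_lt_trans; [apply Cmod_le_abs|]. lra. }
  apply HP. apply C_NormedModule_mixin_compat1.
  rewrite E by (eapply Rlt_le_trans; [exact hz'|apply Rmin_l]).
  replace ((f a + (z - a) * q z - f a) / (z - a)) with (q z).
  - apply Hd. eapply Rlt_le_trans; [exact hz'|apply Rmin_r].
  - field. now apply Cminus_eq_contra.
Qed.

Lemma analytic_eq_at_limit (f g : C -> C) (a : C) (r : R) :
  (0 < r)%R -> analytic_at f a -> analytic_at g a ->
  (forall z, disk a r z -> z <> a -> f z = g z) -> f a = g a.
Proof.
  intros hr Hf Hg E. apply NNPP. intros hne.
  assert (he : (0 < Cmod (f a - g a) / 2)%R).
  { assert (0 < Cmod (f a - g a))%R; [|lra]. now apply Cmod_gt_0, Cminus_eq_contra. }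
  destruct (analytic_continuous f a _ Hf he) as [d [hd Hd]].
  destruct (analytic_continuous g a _ Hg he) as [d' [hd' Hd']].
  set (s := (Rmin r (Rmin d d') / 2)%R).
  assert (h0 : (0 < Rmin r (Rmin d d'))%R) by (repeat apply Rmin_pos; lra).
  assert (h1 := Rmin_l r (Rmin d d')). assert (h2 := Rmin_r r (Rmin d d')).
  assert (h3 := Rmin_l d d'). assert (h4 := Rmin_r d d').
  set (z := a + RtoC s).
  assert (hz : Cmod (z - a) = s).
  { unfold z. replace (a + RtoC s - a) with (RtoC s) by ring.
    rewrite Cmod_R, Rabs_pos_eq; unfold s; lra. }
  assert (hs : (0 < s < r /\ s < d /\ s < d')%R) by (unfold s; lra).
  specialize (Hd z). specialize (Hd' z). unfold disk in Hd, Hd'.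
  rewrite hz in Hd, Hd'. specialize (Hd ltac:(lra)). specialize (Hd' ltac:(lra)).
  rewrite <- E in Hd'.
  - assert (Cmod (f a - g a) <= Cmod (f z - f a) + Cmod (f z - g a))%R; [|lra].
    rewrite <- (Cmod_opp (f z - f a)).
    eapply Rle_trans; [|apply Cmod_triangle]. right. f_equal. ring.
  - unfold disk. lra.
  - intros k. rewrite k in hz. replace (a - a) with (RtoC 0) in hz by ring.
    rewrite Cmod_0 in hz. lra.
Qed.

(** * Disk automorphisms and the Pick identity *)

Lemma one_minus_conj_neq_0 (a z : C) :
  (Cmod a < 1)%R -> (Cmod z <= 1)%R -> 1 - Cconj a * z <> 0.
Proof.
  intros ha hz k. apply Ceq_minus in k. apply (f_equal Cmod) in k.
  rewrite Cmod_mult, Cmod_conj, Cmod_1 in k.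
  assert (h1 := Cmod_ge_0 a). assert (h2 := Cmod_ge_0 z). nra.
Qed.

Lemma one_plus_conj_neq_0 (a z : C) :
  (Cmod a < 1)%R -> (Cmod z <= 1)%R -> 1 + Cconj a * z <> 0.
Proof.
  intros ha hz. replace (1 + Cconj a * z) with (1 - Cconj (- a) * z).
  - apply one_minus_conj_neq_0; [now rewrite Cmod_opp|exact hz].
  - rewrite Copp_conj. ring.
Qed.

Lemma T_bracket (a z : C) : T a z = bracket z (- a).
Proof.
  unfold T, bracket. rewrite Copp_conj. f_equal; ring.
Qed.

Lemma T_opp (a z : C) : T (- a) z = bracket z a.
Proof. rewrite T_bracket. f_equal. ring. Qed.

Lemma pick_identity (z w : C) :
  (Cmod (1 - Cconj w * z) ^ 2 - Cmod (z - w) ^ 2 = (1 - Cmod z ^ 2) * (1 - Cmod w ^ 2))%R.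
Proof.
  rewrite !Cmod2_alt. destruct z as [x y], w as [u v]. simpl. ring.
Qed.

Lemma bracket_sqr (z w : C) :
  (Cmod w < 1)%R -> (Cmod z <= 1)%R ->
  (Cmod (bracket z w) ^ 2 =
   1 - (1 - Cmod z ^ 2) * (1 - Cmod w ^ 2) / Cmod (1 - Cconj w * z) ^ 2)%R.
Proof.
  intros hw hz. assert (hn := one_minus_conj_neq_0 w z hw hz).
  unfold bracket. rewrite Cmod_div by exact hn. rewrite <- pick_identity.
  apply Cmod_gt_0 in hn. field. lra.
Qed.

Lemma bracket_le_1 (z w : C) :
  (Cmod w < 1)%R -> (Cmod z <= 1)%R -> (Cmod (bracket z w) <= 1)%R.
Proof.
  intros hw hz. assert (hn := one_minus_conj_neq_0 w z hw hz).
  unfold bracket. rewrite Cmod_div by exact hn.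
  assert (E := pick_identity z w). apply Cmod_gt_0 in hn.
  assert (h1 := Cmod_ge_0 z). assert (h2 := Cmod_ge_0 w). assert (h3 := Cmod_ge_0 (z - w)).
  apply Rle_div_l; [lra|].
  assert (0 <= (1 - Cmod z ^ 2) * (1 - Cmod w ^ 2))%R by (apply Rmult_le_pos; nra). nra.
Qed.

Lemma T_le_1 (a z : C) :
  (Cmod a < 1)%R -> (Cmod z <= 1)%R -> (Cmod (T a z) <= 1)%R.
Proof.
  intros ha hz. rewrite T_bracket. apply bracket_le_1; [now rewrite Cmod_opp|exact hz].
Qed.

Lemma T_0 (a : C) : T a 0 = a.
Proof. unfold T. field. Qed.

Lemma T_self (a : C) : T (- a) a = 0.
Proof. rewrite T_opp. unfold bracket, Cdiv. ring. Qed.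

Lemma Cmod2_one_minus_neq_0 (a : C) : (Cmod a < 1)%R -> 1 - a * Cconj a <> 0.
Proof. intros ha. rewrite Cmult_comm. apply one_minus_conj_neq_0; lra. Qed.

Lemma T_of_bracket (a z : C) :
  (Cmod a < 1)%R -> (Cmod z <= 1)%R -> T a (bracket z a) = z.
Proof.
  intros ha hz. unfold T, bracket. assert (h1 := one_minus_conj_neq_0 a z ha hz).
  assert (h2 := Cmod2_one_minus_neq_0 a ha). field. split; [exact h1|].
  intros k. apply h2. rewrite <- k. ring.
Qed.

Lemma bracket_of_T (a z : C) :
  (Cmod a < 1)%R -> (Cmod z <= 1)%R -> bracket (T a z) a = z.
Proof.
  intros ha hz. unfold T, bracket. assert (h1 := one_plus_conj_neq_0 a z ha hz).
  assert (h2 := Cmod2_one_minus_neq_0 a ha). field. split; [exact h1|].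
  intros k. apply h2. rewrite <- k. ring.
Qed.

Lemma bracket_neq_0 (z w : C) :
  (Cmod w < 1)%R -> (Cmod z <= 1)%R -> z <> w -> bracket z w <> 0.
Proof.
  intros hw hz hne k. apply hne. rewrite <- (T_of_bracket w z hw hz), k. apply T_0.
Qed.

Lemma not_unimodular_constant (f : C -> C) (z : C) :
  unit_disk z -> (Cmod (f z) < 1)%R -> ~ unimodular_constant f.
Proof. intros hz hf [c [hc H]]. rewrite (H z hz) in hf. lra. Qed.

Lemma Delta_h_off (f : C -> C) (z0 z : C) :
  unit_disk z0 -> (Cmod (f z0) < 1)%R -> z <> z0 ->
  Delta_h z0 f z = bracket (f z) (f z0) / bracket z z0.
Proof.
  intros hz0 hf hz. unfold Delta_h.
  destruct (excluded_middle_informative _) as [k|_];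
    [now apply (not_unimodular_constant f z0) in k|].
  now destruct (Ceq_dec z z0).
Qed.

Lemma Delta_h_at (f : C -> C) (z0 : C) :
  unit_disk z0 -> (Cmod (f z0) < 1)%R ->
  Delta_h z0 f z0 = RtoC (1 - Cmod z0 ^ 2) * C_derive f z0 / RtoC (1 - Cmod (f z0) ^ 2).
Proof.
  intros hz0 hf. unfold Delta_h.
  destruct (excluded_middle_informative _) as [k|_];
    [now apply (not_unimodular_constant f z0) in k|].
  now destruct (Ceq_dec z0 z0).
Qed.

Lemma analytic_bracket (f : C -> C) (w a : C) :
  analytic_at f a -> (Cmod w < 1)%R -> (Cmod (f a) <= 1)%R ->
  analytic_at (fun z => bracket (f z) w) a.
Proof.
  intros Hf hw hfa. apply analytic_div.
  - apply analytic_minus; [exact Hf|apply analytic_const].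
  - apply analytic_minus; [apply analytic_const|].
    apply analytic_mult; [apply analytic_const|exact Hf].
  - now apply one_minus_conj_neq_0.
Qed.

Lemma unit_disk_interior (a : C) :
  unit_disk a -> exists r, (0 < r)%R /\ forall z, disk a r z -> unit_disk z.
Proof.
  intros ha. rewrite unit_disk_Cmod in ha. exists (1 - Cmod a)%R. split; [lra|].
  intros z hz. unfold disk in hz. rewrite unit_disk_Cmod.
  replace z with (z - a + a) by ring. eapply Rle_lt_trans; [apply Cmod_triangle|]. lra.
Qed.

(** Near [z0], write [f z = f z0 + (z - z0) * q z]. The factor [z - z0] cancels from the quotient of
    brackets, and the resulting analytic formula also takes the prescribed value at [z0], because
    [C_derive f z0 = q z0]. *)
Lemma Delta_h_analytic (f : C -> C) (z0 a : C) :
  schur f -> unit_disk z0 -> (Cmod (f z0) < 1)%R -> unit_disk a ->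
  analytic_at (Delta_h z0 f) a.
Proof.
  intros [Hf Hb] hz0 hf ha.
  destruct (unit_disk_interior a ha) as [s [hs Hs]].
  assert (hz0' := proj1 (unit_disk_Cmod z0) hz0).
  assert (ha' := proj1 (unit_disk_Cmod a) ha).
  destruct (Ceq_dec a z0) as [->|hne].
  - destruct (analytic_quotient f z0 (Hf z0 hz0)) as (q & r & hr & Hq & E).
    apply (analytic_ext
      (fun z => q z * (1 - Cconj z0 * z) / (1 - Cconj (f z0) * f z)) _ z0 (Rmin r s)).
    + now apply Rmin_pos.
    + intros z hz. assert (hzr : disk z0 r z) by (eapply Rlt_le_trans; [exact hz|apply Rmin_l]).
      assert (hzs : disk z0 s z) by (eapply Rlt_le_trans; [exact hz|apply Rmin_r]).
      apply Hs in hzs.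
      assert (n1 : 1 - Cconj z0 * z <> 0).
      { apply one_minus_conj_neq_0; [exact hz0'|]. rewrite unit_disk_Cmod in hzs. lra. }
      assert (n2 : 1 - Cconj (f z0) * f z <> 0).
      { apply one_minus_conj_neq_0; [exact hf|now apply Hb]. }
      destruct (Ceq_dec z z0) as [->|hzz].
      * rewrite Delta_h_at, (derive_of_quotient f q z0 r hr Hq E) by assumption.
        rewrite !RtoC_minus, !Cmod2_conj.
        rewrite (Cmult_comm z0), (Cmult_comm (f z0)). field. exact n2.
      * rewrite Delta_h_off by assumption. unfold bracket.
        assert (n3 : z - z0 <> 0) by now apply Cminus_eq_contra.
        replace (f z - f z0) with ((z - z0) * q z) by (rewrite (E z hzr); ring).
        field. repeat split; assumption.
    + apply analytic_div.
      * apply analytic_mult; [exact Hq|]. apply analytic_minus; [apply analytic_const|].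
        apply analytic_mult; [apply analytic_const|apply analytic_id].
      * apply analytic_minus; [apply analytic_const|].
        apply analytic_mult; [apply analytic_const|now apply Hf].
      * apply one_minus_conj_neq_0; lra.
  - apply (analytic_ext (fun z => bracket (f z) (f z0) / bracket z z0) _ a (Cmod (a - z0))).
    + now apply Cmod_gt_0, Cminus_eq_contra.
    + intros z hz. rewrite Delta_h_off; [reflexivity|assumption|assumption|].
      intros ->. unfold disk in hz. rewrite <- Cmod_opp in hz.
      replace (- (z0 - a)) with (a - z0) in hz by ring. lra.
    + apply analytic_div.
      * apply analytic_bracket; [now apply Hf|exact hf|now apply Hb].
      * apply (analytic_bracket (fun z => z)); [apply analytic_id|exact hz0'|lra].
      * apply bracket_neq_0; [exact hz0'|lra|exact hne].
Qed.

(* On |w| = r the numerator of Delta f is at most 1 and its denominator tends to 1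
   uniformly as r -> 1. *)
Lemma Delta_h_bound (f : C -> C) (z0 z : C) :
  schur f -> unit_disk z0 -> (Cmod (f z0) < 1)%R -> unit_disk z ->
  (Cmod (Delta_h z0 f z) <= 1)%R.
Proof.
  intros Hs hz0 hf hz. assert (Hb := proj2 Hs).
  assert (hz0' := proj1 (unit_disk_Cmod z0) hz0).
  assert (hz' := proj1 (unit_disk_Cmod z) hz).
  assert (c0 := Cmod_ge_0 z0). assert (c1 := Cmod_ge_0 z).
  apply Rnot_lt_le. intros hv. set (v := Cmod (Delta_h z0 f z)) in *.
  set (m := ((1 + v) / 2)%R). assert (hm : (1 < m < v)%R) by (unfold m; lra).
  set (k := ((1 - Cmod z0) ^ 2)%R). assert (hk : (0 < k)%R) by (apply pow_lt; lra).
  (* On [Cmod w = r] one has [1 - Cmod (bracket w z0) ^ 2 <= (1 - r ^ 2) / k]. So [1 - r ^ 2 <= e]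
     suffices for [Cmod (bracket w z0) >= / m]. *)
  set (e := (k * (1 - / m ^ 2))%R).
  assert (hm2 : (0 < / m ^ 2 < 1)%R).
  { split; [apply Rinv_0_lt_compat; nra|]. replace 1%R with (/ 1)%R by apply Rinv_1. apply Rinv_lt_contravar; nra. }
  assert (he : (0 < e)%R) by (apply Rmult_lt_0_compat; lra).
  (* The first bound yields [1 - r ^ 2 <= e], the second puts [z] inside the closed disk, and the
     third keeps [z0] off the circle. *)
  set (r := Rmax (1 - e / 2) (Rmax (Cmod z) ((1 + Cmod z0) / 2))).
  assert (r1 : (1 - e / 2 <= r)%R) by apply Rmax_l.
  assert (r2 : (Rmax (Cmod z) ((1 + Cmod z0) / 2) <= r)%R) by apply Rmax_r.
  assert (r3 := Rmax_l (Cmod z) ((1 + Cmod z0) / 2)).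
  assert (r4 := Rmax_r (Cmod z) ((1 + Cmod z0) / 2)).
  assert (r5 : (r < 1)%R) by (repeat apply Rmax_lub_lt; lra).
  assert (H : (v <= m)%R); [|lra].
  apply (maximum_principle (Delta_h z0 f) r m); [|lra| |lra].
  - intros a ha. now apply Delta_h_analytic.
  - intros w hw. assert (hwz : w <> z0) by (intros ->; lra).
    rewrite Delta_h_off by assumption.
    assert (hb := bracket_neq_0 w z0 hz0' ltac:(lra) hwz).
    rewrite Cmod_div by exact hb. apply Cmod_gt_0 in hb.
    assert (N : (Cmod (bracket (f w) (f z0)) <= 1)%R).
    { apply bracket_le_1; [exact hf|]. apply Hb, unit_disk_Cmod. lra. }
    apply Rle_div_l; [lra|]. eapply Rle_trans; [exact N|].
    assert (D := bracket_sqr w z0 hz0' ltac:(lra)). rewrite hw in D.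
    set (n := Cmod (1 - Cconj z0 * w)) in *.
    assert (hn : (1 - Cmod z0 <= n)%R).
    { unfold n. assert (Cmod 1 <= Cmod (1 - Cconj z0 * w) + Cmod (Cconj z0 * w))%R.
      { eapply Rle_trans; [|apply Cmod_triangle]. right. f_equal. ring. }
      rewrite Cmod_1, Cmod_mult, Cmod_conj, hw in H. nra. }
    assert (hn2 : (k <= n ^ 2)%R) by (unfold k; apply pow_incr; lra).
    assert (hq : ((1 - r ^ 2) * (1 - Cmod z0 ^ 2) / n ^ 2 <= 1 - / m ^ 2)%R).
    { apply Rle_div_l; [lra|]. apply Rle_trans with ((1 - / m ^ 2) * k)%R.
      - replace ((1 - / m ^ 2) * k)%R with e by (unfold e; ring).
        assert (0 <= 1 - r ^ 2 <= e)%R by nra. assert (0 <= 1 - Cmod z0 ^ 2 <= 1)%R by nra. nra.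
      - apply Rmult_le_compat_l; lra. }
    assert (hB : (/ m ^ 2 <= Cmod (bracket w z0) ^ 2)%R) by lra.
    set (b := Cmod (bracket w z0)) in *.
    assert ((1 <= (m * b) ^ 2)%R).
    { rewrite Rpow_mult_distr.
      replace 1%R with (m ^ 2 * / m ^ 2)%R by (field; lra).
      apply Rmult_le_compat_l; [nra|exact hB]. }
    assert (0 < m * b)%R by (apply Rmult_lt_0_compat; lra). nra.
Qed.

Lemma schur_Delta_h (f : C -> C) (z0 : C) :
  schur f -> unit_disk z0 -> (Cmod (f z0) < 1)%R -> schur (Delta_h z0 f).
Proof.
  intros Hs hz0 hf. split; intros a ha; [now apply Delta_h_analytic|now apply Delta_h_bound].
Qed.

Lemma T_Delta_h (f : C -> C) (z0 z : C) :
  schur f -> unit_disk z0 -> (Cmod (f z0) < 1)%R -> unit_disk z ->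
  f z = T (f z0) (T (- z0) z * Delta_h z0 f z).
Proof.
  intros Hs hz0 hf hz.
  destruct (Ceq_dec z z0) as [->|hne].
  - now rewrite T_self, Cmult_0_l, T_0.
  - rewrite Delta_h_off, T_opp by assumption. rewrite unit_disk_Cmod in hz0.
    assert (hz' := hz). rewrite unit_disk_Cmod in hz'.
    replace (bracket z z0 * (bracket (f z) (f z0) / bracket z z0))
      with (bracket (f z) (f z0)).
    + symmetry. apply T_of_bracket; [exact hf|]. now apply (proj2 Hs).
    + field. apply bracket_neq_0; [exact hz0|lra|exact hne].
Qed.

Lemma schur_const (c : C) : (Cmod c <= 1)%R -> schur (fun _ => c).
Proof. intros hc. split; intros a _; [apply analytic_const|exact hc]. Qed.

Lemma schur_ext (f g : C -> C) :
  (forall z, unit_disk z -> f z = g z) -> schur f -> schur g.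
Proof.
  intros E [Hf Hb]. split; intros a ha.
  - destruct (unit_disk_interior a ha) as [r [hr Hr]].
    apply (analytic_ext f g a r hr); [|now apply Hf]. intros z hz. apply E. now apply Hr.
  - rewrite <- E by exact ha. now apply Hb.
Qed.

Lemma schur_T (h : C -> C) (z0 c : C) :
  schur h -> unit_disk z0 -> (Cmod c < 1)%R -> schur (fun z => T c (T (- z0) z * h z)).
Proof.
  intros [Hh Hb] hz0 hc. rewrite unit_disk_Cmod in hz0.
  assert (hprod : forall z, unit_disk z -> (Cmod (T (- z0) z * h z) <= 1)%R).
  { intros z hz. rewrite Cmod_mult. assert (h1 := Hb z hz).
    rewrite unit_disk_Cmod in hz.
    assert (h2 : (Cmod (T (- z0) z) <= 1)%R) by (apply T_le_1; [now rewrite Cmod_opp|lra]).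
    assert (h3 := Cmod_ge_0 (h z)). assert (h4 := Cmod_ge_0 (T (- z0) z)). nra. }
  split; intros a ha.
  - apply (analytic_ext (fun z => bracket (bracket z z0 * h z) (- c)) _ a 1); [lra| |].
    + intros z _. now rewrite T_bracket, T_opp.
    + apply (analytic_bracket (fun z => bracket z z0 * h z)).
      * apply analytic_mult; [|now apply Hh].
        rewrite unit_disk_Cmod in ha.
        apply (analytic_bracket (fun z => z)); [apply analytic_id|exact hz0|lra].
      * now rewrite Cmod_opp.
      * rewrite <- T_opp. now apply hprod.
  - apply T_le_1; [exact hc|now apply hprod].
Qed.

(** Off [z0] this is [bracket_of_T]. At [z0] both sides are analytic and agree nearby, so continuity
    settles the value without computing a derivative. *)
Lemma Delta_h_T (f h : C -> C) (z0 c : C) :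
  schur h -> unit_disk z0 -> (Cmod c < 1)%R ->
  (forall z, unit_disk z -> f z = T c (T (- z0) z * h z)) ->
  forall z, unit_disk z -> Delta_h z0 f z = h z.
Proof.
  intros Hh hz0 hc E. assert (hz0' := proj1 (unit_disk_Cmod z0) hz0).
  assert (Hf : schur f).
  { apply (schur_ext (fun z => T c (T (- z0) z * h z))); [intros; symmetry; now apply E|].
    now apply schur_T. }
  assert (Ef0 : f z0 = c) by (rewrite E, T_self, Cmult_0_l by exact hz0; apply T_0).
  assert (Hoff : forall z, unit_disk z -> z <> z0 -> Delta_h z0 f z = h z).
  { intros z hz hne. rewrite Delta_h_off by (congruence || assumption).
    rewrite Ef0, E by exact hz. assert (hb := proj2 Hh z hz).
    rewrite unit_disk_Cmod in hz.
    assert (hbr := bracket_neq_0 z z0 hz0' ltac:(lra) hne).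
    rewrite T_opp, bracket_of_T; [field; exact hbr|exact hc|].
    rewrite Cmod_mult. assert (h1 := bracket_le_1 z z0 hz0' ltac:(lra)).
    assert (h2 := Cmod_ge_0 (bracket z z0)). assert (h3 := Cmod_ge_0 (h z)). nra. }
  intros z hz. destruct (Ceq_dec z z0) as [->|hne]; [|now apply Hoff].
  destruct (unit_disk_interior z0 hz0) as [r [hr Hr]].
  apply (analytic_eq_at_limit _ _ z0 r hr).
  - apply Delta_h_analytic; congruence || assumption.
  - now apply Hh.
  - intros w hw hne. apply Hoff; [now apply Hr|exact hne].
Qed.

(** * The class S(gamma) and its value sets *)

(** Iterating from the inside, [H^(j+1) f] is [H^j] of [Delta_h z0 f], so the tuple shifts by one
    and the condition on [H^1 f] becomes a condition on a value. The inductions over [n] rest on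
    this. *)
Lemma schur_interp_S (n : nat) (z0 : C) (gamma : nat -> C) (f : C -> C) :
  unit_disk z0 -> (Cmod (gamma 0%nat) < 1)%R ->
  schur_interp (S n) z0 gamma f <->
  schur f /\ f z0 = gamma 0%nat /\
    schur_interp n z0 (fun k => gamma (S k)) (Delta_h z0 f).
Proof.
  intros hz0 h0. split.
  - intros [Hf [H0 H]]. split; [exact Hf|]. split; [exact H0|]. split.
    + apply schur_Delta_h; [exact Hf|exact hz0|now rewrite H0].
    + split; [now apply (H 1%nat); lia|]. intros j hj.
      rewrite <- (H (S j)) by lia. unfold hyp_derive. now rewrite Nat.iter_succ_r.
  - intros [Hf [H0 [_ [H1 H]]]]. split; [exact Hf|]. split; [exact H0|].
    intros [|[|j]] hj; [lia|exact H1|]. rewrite <- (H (S j)) by lia.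
    unfold hyp_derive. now rewrite (Nat.iter_succ_r (S j)).
Qed.

(** Functions are total, so invariance under changes off the disk needs proof. Derivatives are not
    compared: [g] inherits the representation [T (f z0) (T (- z0) w * Delta_h z0 f w)], from which
    [Delta_h_T] recovers [Delta_h z0 g]. *)
Lemma schur_interp_ext (n : nat) (z0 : C) (gamma : nat -> C) (f g : C -> C) :
  unit_disk z0 -> (forall k, (k <= n)%nat -> unit_disk (gamma k)) ->
  (forall z, unit_disk z -> f z = g z) ->
  schur_interp n z0 gamma f -> schur_interp n z0 gamma g.
Proof.
  intros hz0. revert gamma f g. induction n as [|n IH]; intros gamma f g hgam E H.
  - destruct H as [Hf [H0 _]]. split; [now apply (schur_ext f g)|].
    split; [now rewrite <- E|]. intros j hj. lia.
  - assert (h0 := hgam 0%nat ltac:(lia)). rewrite unit_disk_Cmod in h0.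
    apply schur_interp_S in H; [|assumption|assumption]. destruct H as [Hf [H0 H]].
    apply schur_interp_S; [assumption|assumption|].
    split; [now apply (schur_ext f g)|]. split; [now rewrite <- E|].
    apply (IH _ (Delta_h z0 f)); [intros k hk; apply hgam; lia| |exact H].
    intros z hz. symmetry. rewrite <- H0 in h0.
    apply (Delta_h_T g (Delta_h z0 f) z0 (f z0)); try assumption.
    + now apply schur_Delta_h.
    + intros w hw. rewrite <- E by exact hw. now apply T_Delta_h.
Qed.

Lemma schur_interp_f_gamma (n : nat) (z0 : C) (gamma : nat -> C) (g : C -> C) :
  unit_disk z0 -> (forall k, (k <= n)%nat -> unit_disk (gamma k)) -> schur g ->
  schur_interp n z0 gamma (fun z => f_gamma n z0 gamma (g z) z).
Proof.
  intros hz0 hgam Hg. revert gamma hgam. induction n as [|n IH]; intros gamma hgam;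
    assert (h0 := hgam 0%nat ltac:(lia)); rewrite unit_disk_Cmod in h0; simpl f_gamma.
  - split; [|split].
    + apply (schur_ext (fun z => T (gamma 0%nat) (T (- z0) z * g z))).
      * intros z _. now rewrite Cmult_comm.
      * now apply schur_T.
    + now rewrite T_self, Cmult_0_r, T_0.
    + intros j hj. lia.
  - set (h := fun z => f_gamma n z0 (fun k => gamma (S k)) (g z) z).
    assert (hgam' : forall k, (k <= n)%nat -> unit_disk (gamma (S k)))
      by (intros k hk; apply hgam; lia).
    assert (Hh := IH _ hgam'). fold h in Hh.
    apply schur_interp_S; [assumption|assumption|]. split; [|split].
    + apply (schur_T h); [exact (proj1 Hh)|assumption|assumption].
    + now rewrite T_self, Cmult_0_l, T_0.
    + apply (schur_interp_ext n z0 _ h); [assumption|assumption| |exact Hh].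
      intros z hz. symmetry.
      apply (Delta_h_T _ h z0 (gamma 0%nat)); [exact (proj1 Hh)|assumption..|reflexivity|assumption].
Qed.

(** The parameter is [g = Delta_h^(n+1) f]: each induction step peels off one layer, and the base
    case [n = 0] peels off the last. *)
Lemma schur_interp_parametrized (n : nat) (z0 : C) (gamma : nat -> C) (f : C -> C) :
  unit_disk z0 -> (forall k, (k <= n)%nat -> unit_disk (gamma k)) ->
  schur_interp n z0 gamma f ->
  exists g, schur g /\ forall z, unit_disk z -> f z = f_gamma n z0 gamma (g z) z.
Proof.
  intros hz0. revert gamma f. induction n as [|n IH]; intros gamma f hgam H;
    assert (h0 := hgam 0%nat ltac:(lia)); rewrite unit_disk_Cmod in h0.
  - destruct H as [Hf [H0 _]]. rewrite <- H0 in h0. exists (Delta_h z0 f). split.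
    + now apply schur_Delta_h.
    + intros z hz. simpl. rewrite <- H0, Cmult_comm. now apply T_Delta_h.
  - apply schur_interp_S in H; [|assumption|assumption]. destruct H as [Hf [H0 H]].
    destruct (IH _ _ (fun k hk => hgam (S k) (le_n_S _ _ hk)) H) as [g [Hg E]].
    exists g. split; [exact Hg|]. intros z hz. simpl.
    rewrite <- E, <- H0 by exact hz. apply T_Delta_h; congruence || assumption.
Qed.

(** * The Moebius matrix of [f_gamma] *)

(** [f_gamma] recurses at its outermost layer, whereas [AB] takes in [gamma (S n)] at the innermost
    one; this reconciles the two. *)
Lemma f_gamma_last (n : nat) (z0 : C) (gamma : nat -> C) (eps z : C) :
  f_gamma (S n) z0 gamma eps z = f_gamma n z0 gamma (T (gamma (S n)) (eps * T (- z0) z)) z.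
Proof.
  revert gamma. induction n as [|n IH]; intros gamma.
  - simpl. f_equal. ring.
  - change (f_gamma (S (S n)) z0 gamma eps z)
      with (T (gamma 0%nat) (T (- z0) z * f_gamma (S n) z0 (fun k => gamma (S k)) eps z)).
    now rewrite IH.
Qed.

Lemma AB_succ (z0 : C) (gamma : nat -> C) (n : nat) (z : C) :
  A z0 gamma (S n) z = T (- z0) z * A z0 gamma n z + Cconj (gamma (S n)) * B z0 gamma n z /\
  A_tilde z0 gamma (S n) z =
    T (- z0) z * A_tilde z0 gamma n z + Cconj (gamma (S n)) * B_tilde z0 gamma n z /\
  B z0 gamma (S n) z = gamma (S n) * T (- z0) z * A z0 gamma n z + B z0 gamma n z /\
  B_tilde z0 gamma (S n) z =
    gamma (S n) * T (- z0) z * A_tilde z0 gamma n z + B_tilde z0 gamma n z.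
Proof.
  unfold A, A_tilde, B, B_tilde. simpl AB. unfold Mmult.
  change (RtoC 0) with (zero : C_Ring).
  repeat split; rewrite coeff_mat_bij by lia; simpl pred; rewrite sum_Sn, sum_O;
    unfold plus, mult; simpl;
    generalize (coeff_mat (zero : C_Ring) (AB z0 gamma n z) 0 0)
      (coeff_mat (zero : C_Ring) (AB z0 gamma n z) 0 1)
      (coeff_mat (zero : C_Ring) (AB z0 gamma n z) 1 0)
      (coeff_mat (zero : C_Ring) (AB z0 gamma n z) 1 1);
    intros a b c d; unfold coeff_mat, mx2; simpl; ring.
Qed.

(** The map [(x, y) |-> (x + Cconj g * y, g * x + y)] scales the indefinite form [|y|^2 - |x|^2] by
    [1 - |g|^2]. It serves both for the recursion of [A], [B] and for the disk automorphism in
    [eps]. *)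
Lemma mobius_norm_identity (g x y : C) :
  (Cmod (g * x + y) ^ 2 - Cmod (x + Cconj g * y) ^ 2 =
   (Cmod y ^ 2 - Cmod x ^ 2) * (1 - Cmod g ^ 2))%R.
Proof.
  rewrite !Cmod2_alt. destruct g, x, y. simpl. ring.
Qed.

Lemma Cmod_lt_of_sqr (x y : C) : (0 < Cmod y ^ 2 - Cmod x ^ 2)%R -> (Cmod x < Cmod y)%R.
Proof. intros H. assert (h1 := Cmod_ge_0 x). assert (h2 := Cmod_ge_0 y). nra. Qed.

(** The norm identity with [x = T (- z0) z * A] and [y = B] carries positivity of [|B|^2 - |A|^2]
    from [n] to [S n]. It keeps the Moebius denominators away from 0 for [Cmod eps <= 1]. *)
Lemma A_lt_B (n : nat) (z0 : C) (gamma : nat -> C) (z : C) :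
  (forall k, (k <= n)%nat -> unit_disk (gamma k)) -> (Cmod (T (- z0) z) <= 1)%R ->
  (Cmod (A z0 gamma n z) < Cmod (B z0 gamma n z))%R.
Proof.
  intros hgam ht. induction n as [|n IH].
  - unfold A, B. simpl. unfold coeff_mat. simpl. rewrite Cmod_conj, Cmod_1.
    apply unit_disk_Cmod, hgam. lia.
  - assert (IH' := IH ltac:(intros; apply hgam; lia)). clear IH.
    destruct (AB_succ z0 gamma n z) as (-> & _ & -> & _).
    assert (hg := hgam (S n) (le_n _)). rewrite unit_disk_Cmod in hg.
    apply Cmod_lt_of_sqr.
    rewrite <- Cmult_assoc, mobius_norm_identity, Cmod_mult.
    assert (h1 := Cmod_ge_0 (gamma (S n))). assert (h2 := Cmod_ge_0 (T (- z0) z)).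
    assert (h3 := Cmod_ge_0 (A z0 gamma n z)).
    assert (Cmod (T (- z0) z) * Cmod (A z0 gamma n z) < Cmod (B z0 gamma n z))%R by nra.
    assert (0 <= Cmod (T (- z0) z) * Cmod (A z0 gamma n z))%R by nra.
    apply Rmult_lt_0_compat; nra.
Qed.

(** This is minus the determinant of [AB]. Each left factor has determinant
    [T (- z0) z * (1 - |gamma (S n)|^2)], while the initial matrix brings no power of [T (- z0) z];
    hence the exponent [n]. *)
Lemma AB_det (n : nat) (z0 : C) (gamma : nat -> C) (z : C) :
  A_tilde z0 gamma n z * B z0 gamma n z - A z0 gamma n z * B_tilde z0 gamma n z =
  T (- z0) z ^ n * RtoC (prod_f_R0 (fun k => (1 - Cmod (gamma k) ^ 2)%R) n).
Proof.
  induction n as [|n IH].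
  - cbn [prod_f_R0]. rewrite RtoC_minus, Cmod2_conj.
    unfold A, B, A_tilde, B_tilde. simpl. unfold coeff_mat. simpl. ring.
  - destruct (AB_succ z0 gamma n z) as (-> & -> & -> & ->).
    cbn [prod_f_R0]. rewrite RtoC_mult, RtoC_minus, Cmod2_conj.
    rewrite Cpow_S.
    transitivity (T (- z0) z * (1 - gamma (S n) * Cconj (gamma (S n))) *
      (A_tilde z0 gamma n z * B z0 gamma n z - A z0 gamma n z * B_tilde z0 gamma n z));
      [ring|]. rewrite IH. ring.
Qed.

Lemma mobius_den_neq_0 (e x y : C) :
  (Cmod x < Cmod y)%R -> (Cmod e <= 1)%R -> e * x + y <> 0.
Proof.
  intros hxy he k. assert (E : y = - (e * x)).
  { replace y with (e * x + y - e * x) by ring. rewrite k. ring. }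
  apply (f_equal Cmod) in E. rewrite Cmod_opp, Cmod_mult in E.
  assert (h1 := Cmod_ge_0 x). assert (h2 := Cmod_ge_0 e). nra.
Qed.

(** Put [t = T (- z0) z]. The two sums are the entries of the row [(eps * t, 1)] times [AB]. A new
    innermost layer replaces this row, up to the scalar [1 + Cconj (gamma (S n)) * (eps * t)], by
    its product with the new left factor of [AB]; the scalar cancels in the quotient. *)
Lemma f_gamma_AB (n : nat) (z0 : C) (gamma : nat -> C) (eps z : C) :
  (forall k, (k <= n)%nat -> unit_disk (gamma k)) ->
  (Cmod (T (- z0) z) <= 1)%R -> (Cmod eps <= 1)%R ->
  f_gamma n z0 gamma eps z =
  (eps * (T (- z0) z * A_tilde z0 gamma n z) + B_tilde z0 gamma n z) /
  (eps * (T (- z0) z * A z0 gamma n z) + B z0 gamma n z).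
Proof.
  intros hgam ht. revert eps. induction n as [|n IH]; intros eps he.
  - unfold A, B, A_tilde, B_tilde. simpl. unfold coeff_mat. simpl. unfold T at 1.
    f_equal; ring.
  - assert (hgam' : forall k, (k <= n)%nat -> unit_disk (gamma k))
      by (intros; apply hgam; lia).
    assert (hg := hgam (S n) (le_n _)). rewrite unit_disk_Cmod in hg.
    assert (het : (Cmod (eps * T (- z0) z) <= 1)%R).
    { rewrite Cmod_mult. assert (h1 := Cmod_ge_0 eps).
      assert (h2 := Cmod_ge_0 (T (- z0) z)). nra. }
    assert (hT := T_le_1 _ _ hg het).
    rewrite f_gamma_last, IH by assumption.
    assert (hAB := A_lt_B n z0 gamma z hgam' ht).
    assert (hX : (Cmod (T (- z0) z * A z0 gamma n z) < Cmod (B z0 gamma n z))%R).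
    { rewrite Cmod_mult. assert (h3 := Cmod_ge_0 (A z0 gamma n z)).
      assert (h2 := Cmod_ge_0 (T (- z0) z)). nra. }
    assert (n1 := mobius_den_neq_0 _ _ _ hX hT).
    assert (n2 := one_plus_conj_neq_0 _ _ hg het).
    destruct (AB_succ z0 gamma n z) as (-> & -> & -> & ->).
    assert (E : 1 + Cconj (gamma (S n)) * (eps * T (- z0) z) <> 0 -> forall a b,
      (1 + Cconj (gamma (S n)) * (eps * T (- z0) z)) *
        (T (gamma (S n)) (eps * T (- z0) z) * (T (- z0) z * a) + b) =
      eps * (T (- z0) z * (T (- z0) z * a + Cconj (gamma (S n)) * b)) +
        (gamma (S n) * T (- z0) z * a + b)).
    { generalize (T (- z0) z). intros s hn a b. unfold T. field. exact hn. }
    rewrite <- (E n2 (A_tilde z0 gamma n z)), <- (E n2 (A z0 gamma n z)).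
    field. split; assumption.
Qed.

(* With [D = |y|^2 - |x|^2] and [c = (conj y q - conj x p) / D], one has
   [(e p + q)/(e x + y) - c = (e conj y + conj x)/(e x + y) * (p y - x q)/D],
   and the first factor is a Moebius automorphism of the unit disk. *)
Lemma mobius_minus_center (e x y p q : C) :
  (Cmod x < Cmod y)%R -> (Cmod e <= 1)%R ->
  (e * p + q) / (e * x + y) - (Cconj y * q - Cconj x * p) / RtoC (Cmod y ^ 2 - Cmod x ^ 2) =
  (e * Cconj y + Cconj x) / (e * x + y) * ((p * y - x * q) / RtoC (Cmod y ^ 2 - Cmod x ^ 2)).
Proof.
  intros hxy he. assert (n1 := mobius_den_neq_0 e x y hxy he).
  assert (n2 : RtoC (Cmod y ^ 2 - Cmod x ^ 2) <> 0).
  { intros k. apply RtoC_inj in k. assert (h := Cmod_ge_0 x). nra. }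
  rewrite RtoC_minus, !Cmod2_conj in *. field. now split.
Qed.

(** The numerator is conjugate to [x + Cconj e * y], so the norm identity gives [|den|^2 - |num|^2 =
    (|y|^2 - |x|^2) * (1 - |e|^2)]. *)
Lemma mobius_factor_le (e x y : C) :
  (Cmod x < Cmod y)%R -> (Cmod e <= 1)%R ->
  (Cmod ((e * Cconj y + Cconj x) / (e * x + y)) <= 1)%R /\
  (Cmod ((e * Cconj y + Cconj x) / (e * x + y)) = 1%R <-> Cmod e = 1%R).
Proof.
  intros hxy he. assert (n1 := mobius_den_neq_0 e x y hxy he).
  rewrite Cmod_div by exact n1. apply Cmod_gt_0 in n1.
  assert (E := mobius_norm_identity e x y).
  replace (Cmod (x + Cconj e * y)) with (Cmod (e * Cconj y + Cconj x)) in E.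
  2:{ rewrite <- Cmod_conj, Cplus_conj, Cmult_conj, !Cconj_conj. f_equal. ring. }
  set (u := Cmod (e * x + y)) in *. set (v := Cmod (e * Cconj y + Cconj x)) in *.
  assert (hv : (0 <= v)%R) by apply Cmod_ge_0. assert (h1 := Cmod_ge_0 x).
  assert (h2 := Cmod_ge_0 e). assert (hD : (0 < Cmod y ^ 2 - Cmod x ^ 2)%R) by nra.
  split; [|split].
  - apply Rle_div_l; [exact n1|].
    assert (0 <= (Cmod y ^ 2 - Cmod x ^ 2) * (1 - Cmod e ^ 2))%R
      by (apply Rmult_le_pos; nra). nra.
  - intros k. assert (k' : v = u).
    { replace v with (v / u * u)%R by (field; lra). rewrite k. ring. }
    rewrite k', Rminus_diag in E. symmetry in E. apply Rmult_integral in E.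
    destruct E as [E|E]; nra.
  - intros k. rewrite k in E.
    assert (k' : v = u) by nra. rewrite k'. field. lra.
Qed.

(** Solving for [e] gives a factor of the same shape with [(- x, Cconj y)] in place of [(x, y)], so
    [mobius_factor_le] also bounds the preimage. *)
Lemma mobius_factor_onto (u x y : C) :
  (Cmod x < Cmod y)%R -> (Cmod u <= 1)%R ->
  exists e, (Cmod e <= 1)%R /\ (e * Cconj y + Cconj x) / (e * x + y) = u.
Proof.
  intros hxy hu.
  assert (hxy' : (Cmod (- x) < Cmod (Cconj y))%R) by now rewrite Cmod_opp, Cmod_conj.
  assert (n1 := mobius_den_neq_0 u (- x) (Cconj y) hxy' hu).
  set (e := (u * y - Cconj x) / (u * (- x) + Cconj y)).
  assert (he : (Cmod e <= 1)%R).
  { destruct (mobius_factor_le u (- x) (Cconj y) hxy' hu) as [k _].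
    rewrite Cconj_conj, Copp_conj in k. exact k. }
  exists e. split; [exact he|].
  assert (n2 := mobius_den_neq_0 e x y hxy he).
  assert (E : (e * Cconj y + Cconj x) = u * (e * x + y)).
  { unfold e. field. exact n1. }
  rewrite E. field. exact n2.
Qed.

Theorem theorem3p2 (n : nat) (z0 : C) (gamma : nat -> C)
    (hz0 : unit_disk z0)
    (hgamma : forall k : nat, (k <= n)%nat -> unit_disk (gamma k))
    (z : C) (hz : unit_disk z) (hzz0 : z <> z0) :
  (forall w : C,
     V n z0 gamma z w <->
     exists eps : C, closed_disk 0 1 eps /\ w = f_gamma n z0 gamma eps z) /\
  (forall w : C,
     (exists eps : C, closed_disk 0 1 eps /\ w = f_gamma n z0 gamma eps z) <->
     closed_disk (center n z0 gamma z) (radius n z0 gamma z) w) /\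
  (forall f : C -> C, schur_interp n z0 gamma f ->
     (disk_boundary (center n z0 gamma z) (radius n z0 gamma z) (f z) <->
      exists eps : C, disk_boundary 0 1 eps /\
        forall zeta : C, unit_disk zeta -> f zeta = f_gamma n z0 gamma eps zeta)).
Proof.
  assert (Hcl : forall e, closed_disk 0 1 e <-> (Cmod e <= 1)%R).
  { intros e. unfold closed_disk. now replace (e - 0) with e by ring. }
  assert (Hbd : forall e, disk_boundary 0 1 e <-> Cmod e = 1%R).
  { intros e. unfold disk_boundary. now replace (e - 0) with e by ring. }
  set (t := T (- z0) z).
  assert (hz0' := proj1 (unit_disk_Cmod z0) hz0). assert (hz' := proj1 (unit_disk_Cmod z) hz).
  assert (ht1 : (Cmod t <= 1)%R) by (apply T_le_1; [rewrite Cmod_opp|]; lra).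
  assert (ht0 : (0 < Cmod t)%R).
  { apply Cmod_gt_0. unfold t. rewrite T_opp. apply bracket_neq_0; [assumption|lra|assumption]. }
  set (x := t * A z0 gamma n z). set (y := B z0 gamma n z).
  set (p := t * A_tilde z0 gamma n z). set (q := B_tilde z0 gamma n z).
  assert (hxy : (Cmod x < Cmod y)%R).
  { assert (k := A_lt_B n z0 gamma z hgamma ht1). unfold x. rewrite Cmod_mult. fold y in k.
    assert (h := Cmod_ge_0 (A z0 gamma n z)). nra. }
  assert (Hf : forall e, (Cmod e <= 1)%R ->
    f_gamma n z0 gamma e z = (e * p + q) / (e * x + y)).
  { intros e he. now apply f_gamma_AB. }
  assert (HD : denom n z0 gamma z = (Cmod y ^ 2 - Cmod x ^ 2)%R).
  { unfold denom, x. rewrite Cmod_mult. fold t y. ring. }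
  assert (hD : (0 < Cmod y ^ 2 - Cmod x ^ 2)%R) by (assert (h := Cmod_ge_0 x); nra).
  assert (Hc : center n z0 gamma z =
    (Cconj y * q - Cconj x * p) / RtoC (Cmod y ^ 2 - Cmod x ^ 2)).
  { unfold center. rewrite HD. f_equal. fold t y q. unfold x, p.
    rewrite Cmod2_conj, Cmult_conj. ring. }
  (* [x] and [p] each absorb one factor [t], which raises the exponent of [AB_det] from [n] to
     [n + 1]. *)
  assert (Hdet : p * y - x * q =
    t ^ (n + 1) * RtoC (prod_f_R0 (fun k => (1 - Cmod (gamma k) ^ 2)%R) n)).
  { rewrite Nat.add_1_r, Cpow_S, <- Cmult_assoc. unfold t at 2. rewrite <- AB_det.
    unfold p, q, x, y. ring. }
  assert (hprod : (0 < prod_f_R0 (fun k => (1 - Cmod (gamma k) ^ 2)%R) n)%R).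
  { clear - hgamma. induction n as [|m IH]; cbn [prod_f_R0].
    - assert (h := hgamma 0%nat (le_n _)). rewrite unit_disk_Cmod in h.
      assert (k := Cmod_ge_0 (gamma 0%nat)). nra.
    - assert (h := hgamma (S m) (le_n _)). rewrite unit_disk_Cmod in h.
      assert (k := Cmod_ge_0 (gamma (S m))).
      apply Rmult_lt_0_compat; [apply IH; intros; apply hgamma; lia|nra]. }
  (* A complex number with the radius as its modulus: it also holds the rotation between
     [f_gamma - center] and the Moebius factor. *)
  set (v := (p * y - x * q) / RtoC (Cmod y ^ 2 - Cmod x ^ 2)).
  assert (nD : RtoC (Cmod y ^ 2 - Cmod x ^ 2) <> 0) by (intros k; apply RtoC_inj in k; lra).
  assert (Hr : radius n z0 gamma z = Cmod v).
  { unfold radius, v. rewrite HD, Cmod_div by exact nD.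
    rewrite Hdet, Cmod_mult, Cmod_pow, !Cmod_R, !Rabs_pos_eq by lra. reflexivity. }
  (* Here [z <> z0] enters, through [t <> 0]. A positive radius allows division by [v] and makes a
     boundary value equivalent to a Moebius factor of modulus 1. *)
  assert (hv : (0 < Cmod v)%R).
  { rewrite <- Hr. unfold radius. rewrite HD. fold t.
    apply Rdiv_lt_0_compat; [|exact hD]. apply Rmult_lt_0_compat; [now apply pow_lt|exact hprod]. }
  assert (Hfc : forall e, (Cmod e <= 1)%R -> f_gamma n z0 gamma e z - center n z0 gamma z =
    (e * Cconj y + Cconj x) / (e * x + y) * v).
  { intros e he. rewrite Hf, Hc by exact he. now apply mobius_minus_center. }
  assert (Hbdry : forall e, (Cmod e <= 1)%R ->
    disk_boundary (center n z0 gamma z) (radius n z0 gamma z) (f_gamma n z0 gamma e z) <->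
    Cmod e = 1%R).
  { intros e he. unfold disk_boundary. rewrite Hfc, Hr, Cmod_mult by exact he.
    destruct (mobius_factor_le e x y hxy he) as [_ <-]. split; intros k; [nra|rewrite k; ring]. }
  split; [|split].
  - intros w. split.
    + intros [f [H ->]].
      destruct (schur_interp_parametrized n z0 gamma f hz0 hgamma H) as [g [Hg E]].
      exists (g z). split; [|now apply E]. apply Hcl. now apply (proj2 Hg).
    + intros [e [he ->]]. rewrite Hcl in he. exists (fun zeta => f_gamma n z0 gamma e zeta).
      split; [|reflexivity].
      apply (schur_interp_f_gamma n z0 gamma (fun _ => e)); [assumption..|].
      apply schur_const, he.
  - intros w. split.
    + intros [e [he ->]]. rewrite Hcl in he. unfold closed_disk.
      rewrite Hfc, Hr, Cmod_mult by exact he.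
      destruct (mobius_factor_le e x y hxy he) as [k _]. nra.
    + intros hw. unfold closed_disk in hw. rewrite Hr in hw.
      assert (nv : v <> 0) by now apply Cmod_gt_0.
      destruct (mobius_factor_onto ((w - center n z0 gamma z) / v) x y hxy) as [e [he Ee]].
      { rewrite Cmod_div by exact nv. apply Rle_div_l; lra. }
      exists e. split; [now apply Hcl|].
      assert (k := Hfc e he). rewrite Ee in k.
      replace ((w - center n z0 gamma z) / v * v) with (w - center n z0 gamma z) in k
        by (field; exact nv).
      replace w with (w - center n z0 gamma z + center n z0 gamma z) by ring.
      rewrite <- k. ring.
  - intros f H. destruct (schur_interp_parametrized n z0 gamma f hz0 hgamma H) as [g [Hg E]].
    split.
    + intros hb. rewrite (E z hz) in hb. apply Hbdry in hb; [|now apply (proj2 Hg)].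
      exists (g z). split; [now apply Hbd|]. intros zeta hzeta.
      rewrite <- (schur_unimodular_value g z Hg hz hb zeta hzeta). now apply E.
    + intros [e [he Ee]]. rewrite Hbd in he. rewrite (Ee z hz). apply Hbdry; lra.
Qed.
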